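(* Suppose that the global minimizer $\omega_\ast := \arg\min_{\omega\in\Omega} \lambda_{\max}(\mathcal{A}(\omega))$ is unique and such that the eigenvalue $\lambda_{\max}(\mathcal{A}(\omega_\ast))$ is multiple, say of algebraic multiplicity $K\ge 2$, and that $$0\notin \mathrm{bd}\,\partial\lambda_j(\mathcal{A}(\omega_\ast))\quad\text{for } j=1,\dots,K .$$ Then the sequence $\{\omega^{(k)}\}$ generated by the Subspace Procedure satisfies $$|\omega^{(k+1)}-\omega_\ast| = O\left((\omega^{(k)}-\omega_\ast)^2\right)$$ for all large $k$.
   Context: Setting. $\Omega\subset\mathbb{R}$ is a closed interval, $\underline{\Omega}\supset\Omega$ is an open interval, $f_1,\dots,f_\kappa:\underline{\Omega}\to\mathbb{R}$ are real analytic, $A_1,\dots,A_\kappa:\ell^2(\mathbb{N})\to\ell^2(\mathbb{N})$ are compact self-adjoint operators, and $\mathcal{A}(\omega):=\sum_{j=1}^{\kappa} f_j(\omega)A_j$ (thought of as infinite-dimensional Hermitian matrices). $\lambda_j(\cdot)$ denotes the $j$th largest eigenvalue (counted with multiplicity) and $\lambda_{\max}=\lambda_1$; it is understood that the eigenvalues referred to exist. Projected operators. For a finite-dimensional subspace $\mathcal{V}$ of dimension $m$, $\mathcal{A}^{\mathcal{V}}(\omega):=V^\ast\mathcal{A}(\omega)V$, where the columns of $V$ form an orthonormal basis of $\mathcal{V}$; this is an $m\times m$ Hermitian matrix-valued function of $\omega$. Subspace Procedure. A parameter $\epsilon>0$ is given. Choose any $\omega^{(1)}\in\Omega$. For each iterate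 $\omega^{(k)}$, let $v^{(k)}_1,\dots,v^{(k)}_{\ell_k}$ be (orthonormal) eigenvectors of $\mathcal{A}(\omega^{(k)})$ corresponding to its $\ell_k$ largest eigenvalues $\lambda_1(\mathcal{A}(\omega^{(k)})),\dots,\lambda_{\ell_k}(\mathcal{A}(\omega^{(k)}))$, namely all eigenvalues satisfying $\lambda_{\max}(\mathcal{A}(\omega^{(k)}))-\lambda_j(\mathcal{A}(\omega^{(k)}))\le\epsilon$ (it is understood that $\ell_k$ is finite). Set $\mathcal{V}_1:=\mathrm{span}\{v^{(1)}_1,\dots,v^{(1)}_{\ell_1}\}$. For $k=1,2,\dots$: let $\omega^{(k+1)}$ be a global minimizer of $\lambda_{\max}(\mathcal{A}^{\mathcal{V}_k}(\omega))$ over $\omega\in\Omega$, and let $\mathcal{V}_{k+1}$ be the sum of $\mathcal{V}_k$ and $\mathrm{span}\{v^{(k+1)}_1,\dots,v^{(k+1)}_{\ell_{k+1}}\}$. Generalized Clarke derivative. For a univariate function $f$ differentiable except on a set $\Gamma$ of measure zero, $\partial f(\omega_\ast):=\mathrm{Co}\{\lim_{k\to\infty} f'(\omega^{(k)}) : \omega^{(k)}\to\omega_\ast,\ \omega^{(k)}\notin\Gamma\ \forall k\}$, with $\mathrm{Co}$ the convex hull; $\partial\lambda_j(\mathcal{A}(\omega_\ast))$ is this set for $f(\omega)=\lambda_j(\mathcal{A}(\omega))$. $\mathrm{bd}$ denotes the boundary in $\mathbb{R}$. The constant in the $O(\cdot)$ bound does not depend on $k$. *)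

(* Defs.v *)
From HB Require Import structures.
From mathcomp Require Import all_boot all_order all_algebra.
From mathcomp Require Import complex.
From mathcomp Require Import all_classical all_reals all_analysis.
From mathcomp Require Import ring.

Set Implicit Arguments.
Unset Strict Implicit.
Unset Printing Implicit Defensive.

Import Order.TTheory GRing.Theory Num.Theory.
Import numFieldNormedType.Exports.

Local Open Scope classical_set_scope.
Local Open Scope ring_scope.
Local Open Scope complex_scope.

Section Ell2.
Context (R : realType).
Import Normc.

Definition square_summable : {pred nat -> R[i]} :=
  fun x => `[< cvgn (series (fun n => normc (x n) ^+ 2)) >].

Lemma square_summable_submod : submod_closed square_summable.
Proof.
split.
  apply/asboolP; rewrite (_ : series _ = fun=> 0); first exact: is_cvg_cst.
  apply/funext => n; rewrite /series/= big1// => i _.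
  by rewrite !expr0n addr0 sqrtr0 expr0n.
move=> c x y /asboolP xs /asboolP ys; apply/asboolP.
pose u := (2 * normc c ^+ 2) *: (fun n => normc (x n) ^+ 2) +
          (2 : R) *: (fun n => normc (y n) ^+ 2).
have normc_ge0 (z : R[i]) : 0 <= normc z by case: z => p q; exact: sqrtr_ge0.
have sqrD_le (p q : R) : (p + q) ^+ 2 <= 2 * p ^+ 2 + 2 * q ^+ 2.
  rewrite -subr_ge0 (_ : _ - _ = (p - q) ^+ 2) ?sqr_ge0//; ring.
have uE n : u n = 2 * (normc c * normc (x n)) ^+ 2 + 2 * normc (y n) ^+ 2.
  by rewrite exprMn mulrA.
apply: (@series_le_cvg _ _ u) => [n|n|n|].
- exact: sqr_ge0.
- by rewrite uE addr_ge0// mulr_ge0// sqr_ge0.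
- have D : normc (c * x n + y n) <= normc c * normc (x n) + normc (y n).
    by rewrite -normcM -lecR rmorphD; exact: (ler_normD (c * x n) (y n)).
  rewrite uE; apply: (le_trans (y := (normc c * normc (x n) + normc (y n)) ^+ 2)).
    by rewrite ler_sqr// nnegrE ?addr_ge0 ?mulr_ge0.
  exact: sqrD_le.
- by apply: is_cvg_seriesD; exact: is_cvg_seriesZ.
Qed.

HB.instance Definition _ :=
  GRing.isSubmodClosed.Build R[i] (nat -> R[i]) square_summable
    square_summable_submod.

Record l2 := L2 { l2val :> nat -> R[i]; _ : l2val \in square_summable }.

HB.instance Definition _ := [isSub for l2val].
HB.instance Definition _ := [Choice of l2 by <:].
HB.instance Definition _ := [SubChoice_isSubLmodule of l2 by <:].

Definition inner (x y : l2) : R[i] :=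
  let u n := x n * (y n)^* in
  limn (series (fun n => complex.Re (u n))) +i*
  limn (series (fun n => complex.Im (u n))).

Definition l2norm (x : l2) : R := Num.sqrt (complex.Re (inner x x)).

Definition orthonormal_family n (v : 'I_n -> l2) : Prop :=
  forall i j, inner (v i) (v j) = (i == j)%:R.

Definition spanned n (v : 'I_n -> l2) : set l2 :=
  [set x | exists c : 'I_n -> R[i], x = \sum_i c i *: v i].

Definition lin_indep n (v : 'I_n -> l2) : Prop :=
  forall c : 'I_n -> R[i], \sum_i c i *: v i = 0 -> forall i, c i = 0.

Definition dim_eq (S : set l2) (n : nat) : Prop :=
  exists v : 'I_n -> l2, lin_indep v /\ spanned v = S.

Definition dim_ge (S : set l2) (n : nat) : Prop :=
  exists v : 'I_n -> l2, lin_indep v /\ spanned v `<=` S.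

Definition compact_operator (T : l2 -> l2) : Prop :=
  forall x : nat -> l2, (exists M : R, forall n, l2norm (x n) <= M) ->
  exists (phi : nat -> nat) (y : l2), {homo phi : m n / (m < n)%N} /\
    l2norm (T (x (phi n)) - y) @[n --> \oo] --> (0 : R).

Definition self_adjoint (T : l2 -> l2) : Prop :=
  forall x y, inner (T x) y = inner x (T y).

(* Eigenvalues are taken in R: all operators below are self-adjoint. *)
Definition is_eigenvalue (T : l2 -> l2) (mu : R) : Prop :=
  exists x : l2, x != 0 /\ T x = mu%:C *: x.

(* Its dimension is the algebraic multiplicity of mu. *)
Definition gen_eigenspace (T : l2 -> l2) (mu : R) : set l2 :=
  [set x | exists n, iter n (fun y => T y - mu%:C *: y) x = 0].

(* [rcons s mu] lists the j largest eigenvalues in nonincreasing order: values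
   above mu occur with their full algebraic multiplicity (possibly 0), mu
   itself at least once and at most as often as its multiplicity allows. *)
Definition is_jth_eigenvalue (T : l2 -> l2) (j : nat) (mu : R) : Prop :=
  exists s : seq R, let t := rcons s mu in
  [/\ size t = j, sorted (fun x y => y <= x) t,
      forall nu, mu < nu -> dim_eq (gen_eigenspace T nu) (count_mem nu t)
    & dim_ge (gen_eigenspace T mu) (count_mem mu t)].

Definition has_jth_eigenvalue (T : l2 -> l2) (j : nat) : Prop :=
  exists mu, is_jth_eigenvalue T j mu.

(* j counts from 1; the value is 0 when there is no jth largest eigenvalue. *)
Definition lambda (j : nat) (T : l2 -> l2) : R :=
  xget 0 (is_jth_eigenvalue T j).

Definition opsum kappa (f : 'I_kappa -> R -> R) (A : 'I_kappa -> l2 -> l2)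
    (w : R) : l2 -> l2 :=
  fun x => \sum_j (f j w)%:C *: A j x.

(* V^* T V, where the columns of V are the v_j. *)
Definition compression m (v : 'I_m -> l2) (T : l2 -> l2) : 'M[R[i]]_m :=
  \matrix_(i, j) inner (T (v j)) (v i).

Definition lambda_max_mx m (M : 'M[R[i]]_m) : R :=
  xget 0 [set mu : R | eigenvalue M mu%:C /\
                       forall nu : R, eigenvalue M nu%:C -> nu <= mu].

Definition global_minimizer (g : R -> R) (Omega : set R) (w : R) : Prop :=
  Omega w /\ forall y, Omega y -> g w <= g y.

(* v is an orthonormal family of eigenvectors for the l largest eigenvalues of
   T, these being exactly the eigenvalues within eps of the largest one. *)
Definition leading_eigenvectors (T : l2 -> l2) (eps : R) l (v : 'I_l -> l2) :
    Prop :=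
  [/\ orthonormal_family v,
      forall i : 'I_l, has_jth_eigenvalue T i.+1 /\
                       T (v i) = (lambda i.+1 T)%:C *: v i,
      forall j, (0 < j)%N -> has_jth_eigenvalue T j ->
        (lambda 1 T - lambda j T <= eps <-> (j <= l)%N)
    & forall mu, is_eigenvalue T mu -> lambda 1 T - mu <= eps ->
        exists i : 'I_l, mu = lambda i.+1 T].

Fixpoint subspace (l : nat -> nat) (v : forall k, 'I_(l k) -> l2) (k : nat) :
    set l2 :=
  if k is k'.+1 then
    [set x + y | x in subspace v k' & y in spanned (v k)]
  else spanned (v 0%N).

(* Iterations are numbered from 0: [w k] is the (k+1)st iterate. *)
Definition subspace_procedure (A : R -> l2 -> l2) (Omega : set R) (eps : R)
    (w : nat -> R) : Prop :=
  Omega (w 0%N) /\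
  exists (l : nat -> nat) (v : forall k, 'I_(l k) -> l2), forall k,
    leading_eigenvectors (A (w k)) eps (v k) /\
    exists (m : nat) (V : 'I_m -> l2),
      [/\ orthonormal_family V, spanned V = subspace v k &
          global_minimizer (fun x => lambda_max_mx (compression V (A x)))
            Omega (w k.+1)].

End Ell2.

Section RealFunctions.
Context {R : realType}.

Definition real_analytic_on (U : set R) (f : R -> R) : Prop :=
  forall c, U c -> exists a : nat -> R,
    \forall x \near c, pseries a (x - c) @ \oo --> f x.

Definition convex_hull (S : set R) : set R :=
  smallest (@convex_set R R^o) S.

Definition boundary (S : set R) : set R := closure S `\` interior S.

(* The exceptional set of the definition is the set of all points where f is
   not differentiable. *)
Definition clarke_derivative (f : R -> R) (w : R) : set R :=
  convex_hull [set L | exists u : nat -> R,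
    [/\ u @ \oo --> w, forall k, derivable f (u k) 1
      & derive1 f (u k) @[k --> \oo] --> L]].

End RealFunctions.

(* Main.v *)
(** Write [A'] for the derivative of [A] at the minimizer [ws], [l] for
    [lambda_1 (A ws)] and [E] for the eigenspace of [A ws] at [l].

    A point where [lambda_1 o A] is differentiable has derivative [<A'(w) x, x>]
    for any unit top eigenvector [x], and such points accumulate at [ws] from
    either side. So if [<A' u, u>] had a constant sign on [E], contrary to what
    the rate below needs, [0] would be an end point of the Clarke derivative of
    [lambda_1 o A]. Hence on each side of [ws] meeting the interval some [u] in
    [E] has [<A' u, u> <> 0], of the sign that makes [<A u, u>] increase away
    from [ws].

    The leading eigenvectors of [A (w k)] span a space containing some [x] with
    [|u - x| = O(w k - ws)], since on its complement [A (w k)] is at most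
    [lambda_1 - eps]. As [u] is an eigenvector, [<A(ws) x, x>] is
    [l |x|^2] up to [O(|u - x|^2)], while minimality of [w k.+1] gives
    [<A(w k.+1) x, x> <= l |x|^2]. Expanding in [w k.+1 - ws] leaves
    [|w k.+1 - ws| <A' u, u> = O((w k - ws)^2)] up to sign.

    That complement bound also forces [lambda_1 (A (w k)) >= eps]: a compact
    operator cannot be bounded above by a negative constant on a subspace of
    finite codimension. So [l > 0], which makes [E] accessible to
    compactness. *)
From HB Require Import structures.
Require Import Defs.
From mathcomp Require Import all_boot all_order all_algebra.
From mathcomp Require Import complex.
From mathcomp Require Import all_classical all_reals all_analysis.
From mathcomp Require Import ring lra.

Set Implicit Arguments.
Unset Strict Implicit.
Unset Printing Implicit Defensive.

Import Order.TTheory GRing.Theory Num.Theory.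
Import numFieldNormedType.Exports.

Local Open Scope classical_set_scope.
Local Open Scope ring_scope.

(** * The real inner product *)

(** The vector [u] is fixed once for each side, and only its distance to the span of the leading
    eigenvectors matters. No eigenvector is followed as [w k] moves, so the splitting of the
    multiple eigenvalue never has to be resolved. Likewise [lambda_1] is handled without analytic
    branches: Rayleigh quotients of fixed vectors touch it from below, parabolas from above.

    The rate presupposes convergence of the iterates. A top eigenvector found at [w j] stays in
    every later subspace, so its Rayleigh quotient at a later iterate is at most [l]. Two iterates
    close to the same point thus force [lambda_1] to be close to [l] there, and uniqueness of the
    minimizer leaves only [ws].

    Most estimates use the real part of the inner product. On an invariant complement of finitely
    many vectors, a bound on the eigenvalues of a compact symmetric operator becomes a bound on its
    form, because a positive supremum of the Rayleigh quotient is attained; this replaces a full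
    spectral theorem. *)

Section RealInnerProduct.
Context {R : realType}.
Implicit Types x y z : l2 R.

Definition ip x y : R := complex.Re (inner x y).

Let ipseq x y n :=
  complex.Re (x n) * complex.Re (y n) + complex.Im (x n) * complex.Im (y n).

Let ipE x y : ip x y = limn (series (ipseq x y)).
Proof.
rewrite /ip /inner /=; congr (limn (series _)); apply/funext => n;
  rewrite /ipseq.
by case: (x n) => p q; case: (y n) => r s /=; ring.
Qed.

Let cvg_ipseqxx x : cvgn (series (ipseq x x)).
Proof.
have /asboolP : l2val x \in @square_summable R by case: x.
rewrite (_ : (fun n => _) = ipseq x x)//; apply/funext => n; rewrite /ipseq.
by case: (l2val x n) => p q /=; rewrite sqr_sqrtr ?addr_ge0 ?sqr_ge0// !expr2.
Qed.

Let cvg_ipseq x y : cvgn (series (ipseq x y)).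
Proof.
apply: normed_cvg.
apply: (@series_le_cvg _ _ (ipseq x x + ipseq y y)) => [n|n|n|].
- exact: normr_ge0.
- by rewrite /ipseq /= !addr_ge0 // -expr2 sqr_ge0.
- rewrite /ipseq /=; set a := complex.Re _; set b := complex.Re _.
  set c := complex.Im _; set d := complex.Im _.
  rewrite ler_norml -[(ipseq x x + _) n]/(a * a + c * c + (b * b + d * d)).
  have := sqr_ge0 (a - b); have := sqr_ge0 (a + b).
  have := sqr_ge0 (c - d); have := sqr_ge0 (c + d).
  by move=> *; apply/andP; split; nra.
- by apply: is_cvg_seriesD; exact: cvg_ipseqxx.
Qed.

Lemma ipC x y : ip x y = ip y x.
Proof.
rewrite !ipE; congr (limn (series _)); apply/funext => n.
by rewrite /ipseq mulrC [X in _ + X]mulrC.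
Qed.

Lemma ipDl x y z : ip (x + y) z = ip x z + ip y z.
Proof.
rewrite !ipE -lim_seriesD//; congr (limn (series _)); apply/funext => n.
rewrite -[RHS]/(ipseq x z n + ipseq y z n) /ipseq.
rewrite -[(x + y) n]/(x n + y n).
by case: (x n) => a b; case: (y n) => c d /=; ring.
Qed.

Lemma ipZl a x y : ip (a%:C%C *: x) y = a * ip x y.
Proof.
rewrite !ipE -[a * _]/(a *: _) -lim_seriesZ//; congr (limn (series _));
  apply/funext => n.
rewrite -[RHS]/(a * ipseq x y n) /ipseq -[(_ *: x) n]/(a%:C%C * x n).
by case: (x n) => b c /=; ring.
Qed.

Lemma ipii x y : ip ('i%C *: x) ('i%C *: y) = ip x y.
Proof.
rewrite !ipE; congr (limn (series _)); apply/funext => n.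
rewrite /ipseq -[(_ *: x) n]/('i%C * x n) -[(_ *: y) n]/('i%C * y n).
by case: (x n) => b c /=; case: (y n) => d e /=; ring.
Qed.

Lemma ip_ge0 x : 0 <= ip x x.
Proof.
rewrite ipE; apply: limr_ge => //; apply: nearW => n.
by apply: sumr_ge0 => i _; rewrite /ipseq addr_ge0// -expr2 sqr_ge0.
Qed.

Lemma ip_eq0 x : ip x x = 0 -> x = 0.
Proof.
rewrite ipE => x0; apply/val_inj/funext => n.
have ge0 i : 0 <= ipseq x x i by rewrite /ipseq addr_ge0// -expr2 sqr_ge0.
have : ipseq x x n <= 0.
  rewrite -x0; apply: limr_ge => //; exists n.+1 => // m /= nm.
  rewrite /series/= (bigD1_seq n) ?iota_uniq ?mem_index_iota//=.
  by rewrite lerDl sumr_ge0.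
change (ipseq x x n <= 0 -> x n = 0); rewrite /ipseq; case: (x n) => a b /= ab.
have : a = 0 /\ b = 0 by split; nra.
by case => -> ->.
Qed.

Lemma inner_ip x y : inner x y = (ip x y +i* ip x ('i%C *: y))%C.
Proof.
rewrite ipE [ip x ('i%C *: y)]ipE /inner; congr (_ +i* _)%C.
  congr (limn (series _)); apply/funext => n; rewrite /ipseq.
  by case: (x n) => p q; case: (y n) => r s /=; ring.
congr (limn (series _)); apply/funext => n; rewrite /ipseq.
rewrite -[(_ *: y) n]/('i%C * y n).
by case: (x n) => p q; case: (y n) => r s /=; ring.
Qed.

End RealInnerProduct.

Local Notation "a *r x" := (a%:C%C *: x) (at level 40).

Section InnerTheory.
Context {R : realType}.
Implicit Types (x y z : l2 R) (a : R).

Lemma ipDr x y z : ip x (y + z) = ip x y + ip x z.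
Proof. by rewrite ipC ipDl ipC [ip z x]ipC. Qed.

Lemma ipZr a x y : ip x (a *r y) = a * ip x y.
Proof. by rewrite ipC ipZl ipC. Qed.

Lemma oppr_scaleN1 x : - x = (-1) *r x.
Proof. by rewrite rmorphN1 scaleN1r. Qed.

Lemma ipNl x y : ip (- x) y = - ip x y.
Proof. by rewrite oppr_scaleN1 ipZl mulN1r. Qed.

Lemma ipNr x y : ip x (- y) = - ip x y.
Proof. by rewrite ipC ipNl ipC. Qed.

Lemma ip0l x : ip 0 x = 0.
Proof. by rewrite -(scale0r 0) -[0 in X in ip X]/(0%:C%C) ipZl mul0r. Qed.

Lemma ip0r x : ip x 0 = 0.
Proof. by rewrite ipC ip0l. Qed.

Definition ipE := (@ipDl R, ipDr, ipNl, ipNr, @ipZl R, ipZr, ip0l, ip0r).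

Lemma ip_suml I (r : seq I) (P : pred I) (F : I -> l2 R) y :
  ip (\sum_(i <- r | P i) F i) y = \sum_(i <- r | P i) ip (F i) y.
Proof. by elim/big_rec2: _ => [|i u v _ <-]; rewrite ?ip0l ?ipDl. Qed.

Lemma ip_gt0 x : x != 0 -> 0 < ip x x.
Proof.
move=> x0; rewrite lt_def ip_ge0 andbT; apply: contra x0 => /eqP h.
by apply/eqP/ip_eq0.
Qed.

Lemma ip_inj x y : (forall z, ip x z = ip y z) -> x = y.
Proof.
move=> xy; apply/eqP; rewrite -subr_eq0; apply/eqP/ip_eq0.
by rewrite ipDl ipNl xy subrr.
Qed.

Lemma l2norm_ge0 x : 0 <= l2norm x. Proof. exact: sqrtr_ge0. Qed.

Lemma sqr_l2norm x : l2norm x ^+ 2 = ip x x.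
Proof. by rewrite sqr_sqrtr// ip_ge0. Qed.

Lemma l2norm_eq1 x : ip x x = 1 -> l2norm x = 1.
Proof. by rewrite /l2norm -/(ip x x) => ->; rewrite sqrtr1. Qed.

Lemma l2norm0 : l2norm (0 : l2 R) = 0.
Proof. by apply/eqP; rewrite -sqrf_eq0 sqr_l2norm ip0l. Qed.

Lemma l2norm_eq0 x : l2norm x = 0 -> x = 0.
Proof. by move=> h; apply: ip_eq0; rewrite -sqr_l2norm h expr0n. Qed.

Lemma l2normZ a x : l2norm (a *r x) = `|a| * l2norm x.
Proof.
apply/eqP; rewrite -(@eqrXn2 _ 2)// ?mulr_ge0 ?l2norm_ge0//.
by rewrite exprMn !sqr_l2norm !ipE real_normK ?num_real// mulrA.
Qed.

Lemma l2normN x : l2norm (- x) = l2norm x.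
Proof. by rewrite oppr_scaleN1 l2normZ normrN1 mul1r. Qed.

Lemma ip_CS x y : `|ip x y| <= l2norm x * l2norm y.
Proof.
rewrite -(@ler_pXn2r _ 2)// ?nnegrE ?mulr_ge0 ?l2norm_ge0//.
rewrite real_normK ?num_real// exprMn !sqr_l2norm.
have [->|y0] := eqVneq y 0; first by rewrite !ipE expr0n mulr0.
have yy := ip_gt0 y0.
have := ip_ge0 (ip y y *r x - ip x y *r y); rewrite !ipE [ip y x]ipC => h.
rewrite -subr_ge0 -(pmulr_rge0 _ yy).
by apply: le_trans h _; rewrite le_eqVlt; apply/orP; left; apply/eqP; ring.
Qed.

Lemma ip_le x y : ip x y <= l2norm x * l2norm y.
Proof. exact: le_trans (ler_norm _) (ip_CS x y). Qed.

Lemma l2normD x y : l2norm (x + y) <= l2norm x + l2norm y.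
Proof.
rewrite -(@ler_pXn2r _ 2)// ?nnegrE ?addr_ge0 ?l2norm_ge0//.
rewrite sqr_l2norm !ipE [ip y x]ipC.
have := ip_le x y; rewrite -!sqr_l2norm; nra.
Qed.

Lemma l2normB x y : l2norm (x - y) <= l2norm x + l2norm y.
Proof. by rewrite -(l2normN y) l2normD. Qed.

Lemma l2norm_distC x y : l2norm (x - y) = l2norm (y - x).
Proof. by rewrite -l2normN opprB. Qed.

Lemma l2normalize x : x != 0 -> ip ((l2norm x)^-1 *r x) ((l2norm x)^-1 *r x) =
  1.
Proof.
move=> x0; have h : l2norm x != 0 by apply: contra x0 => /eqP/l2norm_eq0 ->.
by rewrite !ipE -sqr_l2norm; field.
Qed.

(** A finite list stands for its real span, so [orth F] is a closed real subspace of finite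
    codimension; concatenating lists intersects the subspaces. *)
Definition orth (F : seq (l2 R)) x := forall y, y \in F -> ip x y = 0.

Lemma orthD F x y : orth F x -> orth F y -> orth F (x + y).
Proof. by move=> hx hy z zF; rewrite ipDl hx// hy// addr0. Qed.

Lemma orthZ F a x : orth F x -> orth F (a *r x).
Proof. by move=> hx z zF; rewrite ipZl hx// mulr0. Qed.

Lemma orthN F x : orth F x -> orth F (- x).
Proof. by move=> hx z zF; rewrite ipNl hx// oppr0. Qed.

Lemma orthB F x y : orth F x -> orth F y -> orth F (x - y).
Proof. by move=> hx hy; apply: orthD => //; apply: orthN. Qed.

Lemma orth_cat F G x : orth (F ++ G) x <-> orth F x /\ orth G x.
Proof.
split=> [h|[hF hG] y]; last by rewrite mem_cat => /orP[/hF|/hG].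
by split=> y yF; apply: h; rewrite mem_cat yF ?orbT.
Qed.

Lemma orth_closed F y :
  (forall e, 0 < e -> exists2 x, orth F x & l2norm (x - y) <= e) -> orth F y.
Proof.
move=> h f fF; apply/eqP; rewrite -normr_le0; apply/ler_addgt0Pr => e e0.
rewrite add0r.
have n0 : 0 < l2norm f + 1 by rewrite ltr_wpDl ?l2norm_ge0.
have [x xF xy] := h _ (divr_gt0 e0 n0).
have -> : ip y f = ip (y - x) f by rewrite ipDl ipNl xF// subr0.
apply: le_trans (ip_CS _ _) _; rewrite l2norm_distC.
apply: le_trans (_ : e / (l2norm f + 1) * (l2norm f + 1) <= _).
  by apply: ler_pM; rewrite ?l2norm_ge0// lerDl.
by rewrite divfK// gt_eqF.
Qed.

Let delta n : nat -> R[i] := fun k => (k == n)%:R.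

Let delta_ss n : delta n \in @square_summable R.
Proof.
apply/asboolP; apply: (@is_cvg_near_cst _ _ (1 : R)).
exists n.+1 => // m /= nm.
rewrite /series/= (bigD1_seq n) ?iota_uniq ?mem_index_iota//= /delta eqxx.
rewrite big1 => [|i /negPf ->]; rewrite /Normc.normc/= !expr0n/= ?addr0 ?expr1n.
  by rewrite sqrtr1 expr1n.
by rewrite sqrtr0 expr0n.
Qed.

(** Infinite dimension enters here: the pairings of [size F + 1] coordinate vectors with [F] form a
    matrix with more rows than columns, and its left kernel supplies the coefficients. *)
Lemma exists_orth F : exists2 x, x != 0 & orth F x.
Proof.
pose m := size F; pose e (i : 'I_m.+1) : l2 R := L2 (delta_ss i).
pose M : 'M[R]_(m.+1, m) := \matrix_(i, j) ip (e i) (F`_j).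
have : kermx M != 0.
  by rewrite kermx_eq0 /row_free neq_ltn ltnS rank_leq_col.
move=> /rowV0Pn[c /sub_kermxP cM c0].
exists (\sum_i c 0 i *r e i).
  have /rV0Pn[j cj] := c0; apply: contra cj => /eqP h.
  have := congr1 (fun x : l2 R => complex.Re (x j)) h.
  have vE : l2val (\sum_i c 0 i *r e i) = \sum_i (fun k => (c 0 i)%:C%C * delta
    i k).
    exact: (raddf_sum (\val : l2 R -> nat -> R[i])).
  rewrite vE fct_sumE (bigD1 j)//= big1 => [|i ij].
    by rewrite addr0 /delta eqxx mulr1 /= => ->.
  by rewrite /delta -val_eqE eq_sym in ij *; rewrite (negPf ij) mulr0.
move=> y /(nthP 0)[k km <-]; rewrite ip_suml.
have := congr1 (fun N : 'rV_m => N 0 (Ordinal km)) cM; rewrite !mxE => cM0.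
transitivity (\sum_j c 0 j * M j (Ordinal km)); last exact: cM0.
by apply: eq_bigr => i _; rewrite mxE ipZl.
Qed.

End InnerTheory.

(** * Compact symmetric operators *)

#[local] Opaque ip l2norm inner.

Lemma homo_ltn_ge (phi : nat -> nat) :
  {homo phi : m n / (m < n)%N} -> forall n, (n <= phi n)%N.
Proof.
by move=> h; elim=> // n IHn; apply: leq_ltn_trans IHn _; apply: h.
Qed.

Section CompactOperators.
Context {R : realType}.
Implicit Types (x y z : l2 R) (T B : l2 R -> l2 R).

Definition real_linear T := forall a x y, T (a *r x + y) = a *r T x + T y.

Section RealLinear.
Context (T : l2 R -> l2 R) (Tlin : real_linear T).

Lemma rlinD x y : T (x + y) = T x + T y.
Proof. by have := Tlin 1 x y; rewrite !scale1r. Qed.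

Lemma rlin0 : T 0 = 0.
Proof. by apply: (addrI (T 0)); rewrite -rlinD !addr0. Qed.

Lemma rlinZ a x : T (a *r x) = a *r T x.
Proof. by have := Tlin a x 0; rewrite !addr0 rlin0 addr0. Qed.

Lemma rlinN x : T (- x) = - T x.
Proof. by rewrite oppr_scaleN1 rlinZ -oppr_scaleN1. Qed.

Lemma rlinB x y : T (x - y) = T x - T y.
Proof. by rewrite rlinD rlinN. Qed.

End RealLinear.

Definition ip_symmetric T := forall x y, ip (T x) y = ip x (T y).

Lemma compact_subseq T (x : nat -> l2 R) M : compact_operator T ->
  (forall n, l2norm (x n) <= M) ->
  exists (phi : nat -> nat) y, {homo phi : m n / (m < n)%N} /\
    forall e, 0 < e -> exists N, forall n, (N <= n)%N ->
      l2norm (T (x (phi n)) - y) < e.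
Proof.
move=> cT xM; have [phi [y [hphi h]]] := cT x (ex_intro _ M xM).
exists phi, y; split=> // e e0.
have /cvgrPdist_lt/(_ _ e0)[N _ hN] := h; exists N => n Nn.
by have := hN n Nn; rewrite /= sub0r normrN ger0_norm ?l2norm_ge0.
Qed.

(** Otherwise there are unit vectors [x n] with [T (x n)] longer than [n], and no subsequence of
    these images converges. *)
Lemma compact_operator_bounded T : compact_operator T -> real_linear T ->
  exists C, 0 <= C /\ forall x, l2norm (T x) <= C * l2norm x.
Proof.
move=> cT lT; apply/not_existsP => nC.
have /choice[x xn] (n : nat) : exists x, l2norm x = 1 /\ n%:R < l2norm (T x).
  have /not_andP[|/existsNP[x /negP]] := nC n%:R; first by rewrite ler0n.
  rewrite -ltNge => xn.
  have x0 : 0 < l2norm x.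
    rewrite lt_def l2norm_ge0 andbT; apply/negP => /eqP/l2norm_eq0 xE.
    by move: xn; rewrite xE rlin0// l2norm0 mulr0 ltxx.
  exists ((l2norm x)^-1 *r x);
    rewrite rlinZ// !l2normZ ger0_norm ?invr_ge0 ?ltW//.
  by rewrite mulVf ?gt_eqF//; split=> //; rewrite mulrC ltr_pdivlMr.
have xM n : l2norm (x n) <= 1 by have [->] := xn n.
have [phi [y [hphi /(_ 1 ltr01)[N hN]]]] := compact_subseq cT xM.
have := truncnS_gt (1 + l2norm y); set k := (Num.trunc _).+1 => hk.
have := hN (maxn N k) (leq_maxl _ _); have [_] := xn (phi (maxn N k)).
set u := T _ => un uy.
have : l2norm u <= l2norm (u - y) + l2norm y by rewrite -{1}(subrK y u) l2normD.
have : k%:R <= (phi (maxn N k))%:R :> R.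
  by rewrite ler_nat; apply: leq_trans (leq_maxr N k) (homo_ltn_ge hphi _).
lra.
Qed.

(** Suppose the supremum [M] of the Rayleigh quotient on [orth F] exceeds [c]. Along a maximizing
    sequence [M x - B x] tends to 0, while a subsequence of [B x] converges to some [y]. Since
    [M > c >= 0], the vectors [M x] stay away from 0, so [y] is a nonzero eigenvector for [M],
    against the bound on eigenvalues. *)
Lemma compact_form_attained F B c : compact_operator B -> real_linear B ->
  ip_symmetric B -> (forall x, orth F x -> orth F (B x)) -> 0 <= c ->
  (forall x mu, orth F x -> x != 0 -> B x = mu *r x -> mu <= c) ->
  forall x, orth F x -> ip (B x) x <= c * ip x x.
Proof.
move=> cB lB sB Binv c0 eig x0 Fx0; rewrite leNgt; apply/negP => x0c.
have [C [C0 BC]] := compact_operator_bounded cB lB.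
pose S := [set ip (B x) x | x in [set x | orth F x /\ ip x x = 1]].
have supS : has_sup S.
  split; last first.
    exists C => _ [x [_ xx] <-]; apply: le_trans (ip_le _ _) _.
    by have := BC x; rewrite (l2norm_eq1 xx) !mulr1.
  have x0n : x0 != 0 by apply/negP => /eqP E; move: x0c;
    rewrite E rlin0// !ip0l mulr0 ltxx.
  exists (ip (B ((l2norm x0)^-1 *r x0)) ((l2norm x0)^-1 *r x0)).
  by exists ((l2norm x0)^-1 *r x0) => //; split;
    [exact: orthZ|exact: l2normalize].
pose M := sup S.
have formM x : orth F x -> ip (B x) x <= M * ip x x.
  move=> Fx; have [->|xn] := eqVneq x 0; first by rewrite !ip0r mulr0.
  have : ip (B ((l2norm x)^-1 *r x)) ((l2norm x)^-1 *r x) <= M.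
    apply: sup_ubound; first by case: supS.
    by exists ((l2norm x)^-1 *r x) => //; split;
      [exact: orthZ|exact: l2normalize].
  rewrite rlinZ// !ipE -sqr_l2norm.
  have : 0 < l2norm x by rewrite lt_def l2norm_ge0 andbT;
    apply: contra xn => /eqP/l2norm_eq0->.
  move=> nx; rewrite mulrA -expr2 exprVn mulrC ler_pdivrMr ?exprn_gt0//.
have Mc : c < M.
  rewrite ltNge; apply/negP => Mc; move: x0c; rewrite ltNge => /negP; apply.
  by apply: le_trans (formM _ Fx0) _; apply: ler_wpM2r => //; exact: ip_ge0.
have M0 : 0 < M by apply: le_lt_trans Mc.
have [D DE] : exists D, forall x, D x = M *r x - B x by exists (fun x => M *r x
  - B x).
have lD : real_linear D.
  move=> a u v; rewrite !DE lB scalerDr scalerA [X in X *: u]mulrC -scalerA.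
  by rewrite opprD addrACA scalerBr.
have DF x : orth F x -> orth F (D x) by move=> Fx; rewrite DE; apply: orthB;
  [exact: orthZ|exact: Binv].
have D_ge0 x : orth F x -> 0 <= ip (D x) x.
  by move=> Fx; rewrite DE !ipE subr_ge0 formM.
have Dn x : l2norm (D x) <= (M + C) * l2norm x.
  rewrite DE; apply: le_trans (l2normB _ _) _;
    rewrite mulrDl l2normZ gtr0_norm// lerD2l; exact: BC.
(* Cauchy-Schwarz for the semidefinite form of D, at x and D x *)
have DD x : orth F x -> l2norm (D x) ^+ 2 <= (M + C) * ip (D x) x.
  move=> Fx; set y := D x; have Fy : orth F y by exact: DF.
  have sD u v : ip (D u) v = ip u (D v) by rewrite !DE !ipE sB.
  have yy : ip (D y) y <= (M + C) * ip y y.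
    apply: le_trans (ip_le _ _) _; rewrite -sqr_l2norm expr2 mulrA.
    by apply: ler_wpM2r; [exact: l2norm_ge0|exact: Dn].
  have K0 : 0 < M + C by rewrite ltr_wpDr.
  have := D_ge0 ((M + C) *r x - y) (orthB (orthZ _ Fx) Fy).
  rewrite (rlinB lD) (rlinZ lD) -/y.
  rewrite !ipE [ip (D y) x]sD -/y sqr_l2norm => h.
  have : 0 <= (M + C) * ((M + C) * ip y x - ip y y) by nra.
  by rewrite pmulr_rge0// subr_ge0.
have /choice[x xn] (n : nat) : exists x, [/\ orth F x, ip x x = 1 & M -
  n.+1%:R^-1 < ip (B x) x].
  have [|_ [x [Fx xx] <-] hx] := @sup_adherent _ S n.+1%:R^-1 _ supS.
    by rewrite invr_gt0 ltr0Sn.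
  by exists x.
have xM n : l2norm (x n) <= 1 by have [_ /l2norm_eq1 -> _] := xn n.
have [phi [y [hphi hy]]] := compact_subseq cB xM.
have near_eig e : 0 < e -> exists z, [/\ orth F z, l2norm z = 1,
    l2norm (B z - y) <= e & l2norm (D z) <= e].
  move=> e0; have [N hN] := hy e e0.
  have K0 : 0 < M + C by rewrite ltr_wpDr.
  (* By [DD], [|D z|^2 <= (M + C) (M - <B z, z>)], which is below [e^2] once the defect
     [1 / (n + 1)] is below [e^2 / (M + C)]. *)
  have := truncnS_gt ((M + C) / e ^+ 2); set k := (Num.trunc _).+1 => hk.
  have [Fz zz hz] := xn (phi (maxn N k)); exists (x (phi (maxn N k)));
    split=> //.
  - exact: l2norm_eq1.
  - by apply/ltW/hN; rewrite leq_maxl.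
  - rewrite -(@ler_pXn2r _ 2)// ?nnegrE ?l2norm_ge0 ?(ltW e0)//.
    apply: le_trans (DD _ Fz) _; rewrite DE !ipE zz mulr1.
    have : k%:R <= (phi (maxn N k)).+1%:R :> R.
      by rewrite ler_nat ltnW// ltnS;
        apply: leq_trans (leq_maxr N k) (homo_ltn_ge hphi _).
    move: hz; set j := _.+1%:R => hz kj.
    have j0 : 0 < j by rewrite ltr0Sn.
    have : (M + C) / e ^+ 2 < j by apply: lt_le_trans kj.
    rewrite ltr_pdivrMr ?exprn_gt0// => h.
    apply: (le_trans (y := (M + C) * j^-1)).
      by apply: ler_wpM2l; [exact: ltW|rewrite lerBlDl -lerBlDr ltW].
    by rewrite ler_pdivrMr// mulrC ltW.
have Fy : orth F y.
  apply: orth_closed => e e0; have [z [Fz _ hz _]] := near_eig e e0.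
  by exists (B z) => //; exact: Binv.
have Mzy z : M *r z - y = D z + (B z - y) by rewrite DE addrA subrK.
have yn0 : y != 0.
  (* [y = 0] would give [M = |M z| <= 2 M / 3]. *)
  have [z [_ z1 h1 h2]] := near_eig (M / 3) (divr_gt0 M0 (ltr0n _ 3)).
  apply/negP => /eqP y0; have := l2normD (D z) (B z - y).
  rewrite -Mzy y0 subr0 l2normZ z1 gtr0_norm// mulr1.
  by move: h1; rewrite y0; lra.
suff yM : B y = M *r y by have := eig y M Fy yn0 yM; rewrite leNgt Mc.
apply/eqP; rewrite -subr_eq0; apply/eqP/l2norm_eq0/eqP.
rewrite eq_le l2norm_ge0 andbT; apply/ler_addgt0Pr => e e0; rewrite add0r.
have K0 : 0 < 2 * C + M + 1 by lra.
have [d0 eE] : 0 < e / (2 * C + M + 1) /\ e = e / (2 * C + M + 1) * (2 * C + M +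
  1).
  by split; [exact: divr_gt0|rewrite divfK// gt_eqF].
move: d0 eE; set d := e / _ => d0 ->.
have [z [_ _ h1 h2]] := near_eig _ d0.
have -> : B y - M *r y = M *r (B z - y) - B (M *r z - y).
  by rewrite (rlinB lB) (rlinZ lB) scalerBr opprB [RHS]addrC addrA subrK.
apply: le_trans (l2normB _ _) _; rewrite l2normZ gtr0_norm//.
apply: (le_trans (lerD (ler_wpM2l (ltW M0) h1) (BC _))).
have := l2normD (D z) (B z - y); rewrite -Mzy => h3.
have h4 : l2norm (M *r z - y) <= 2 * d by lra.
apply: (le_trans (lerD (lexx _) (ler_wpM2l C0 h4))).
by rewrite -subr_ge0 (_ : _ - _ = d) ?ltW//; ring.
Qed.

End CompactOperators.

(** * The sign of eigenvalue bounds in finite codimension *)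

Section CompactSpectrum.
Context {R : realType}.
Implicit Types (x y z : l2 R) (T B : l2 R -> l2 R).

(* Otherwise one picks unit vectors x_n with the T x_n pairwise orthogonal and
   longer than d, so that (T x_n) has no Cauchy subsequence. *)
Lemma compact_small T d : compact_operator T -> real_linear T -> ip_symmetric T
  ->
  0 < d -> exists F, forall x, orth F x -> l2norm (T x) <= d * l2norm x.
Proof.
move=> cT lT sT d0; apply/not_existsP => nF.
have /choice[g gP] (F : seq (l2 R)) :
    exists x, [/\ orth F x, l2norm x = 1 & d < l2norm (T x)].
  have /existsNP[x /not_implyP[Fx /negP]] := nF F; rewrite -ltNge => dx.
  have x0 : 0 < l2norm x.
    rewrite lt_def l2norm_ge0 andbT; apply/negP => /eqP/l2norm_eq0 xE.
    by move: dx; rewrite xE (rlin0 lT) l2norm0 mulr0 ltxx.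
  exists ((l2norm x)^-1 *r x); split; first exact: orthZ.
    by rewrite l2normZ ger0_norm ?invr_ge0 ?l2norm_ge0// mulVf// gt_eqF.
  rewrite (rlinZ lT) l2normZ ger0_norm ?invr_ge0 ?l2norm_ge0//.
  by rewrite mulrC ltr_pdivlMr.
(* The list holds [T (T x_m)] rather than [T x_m]: if [x_n] is orthogonal to it, then by symmetry
   [T x_n] is orthogonal to [T x_m]. *)
pose L := fix L n := if n is m.+1 then T (T (g (L m))) :: L m else [::].
have LP m n : (m < n)%N -> T (T (g (L m))) \in L n.
  elim: n => // n IHn; rewrite ltnS leq_eqVlt => /predU1P[->|/IHn h].
    by rewrite /= mem_head.
  by rewrite /= in_cons h orbT.
have TT m n : (m < n)%N -> ip (T (g (L n))) (T (g (L m))) = 0.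
  by move=> mn; have [h _ _] := gP (L n); rewrite sT; apply/h/LP.
have gM n : l2norm (g (L n)) <= 1 by have [_ ->] := gP (L n).
have d2 : 0 < d / 2 by rewrite divr_gt0.
have [phi [y [hphi /(_ _ d2)[N hN]]]] := compact_subseq cT gM.
have := hN _ (leqnn N); have := hN _ (leqnSn N).
have [_ _] := gP (L (phi N)).
have := TT _ _ (hphi _ _ (ltnSn N)).
set u := T _; set v := T _; clearbody u v => uv dv uy vy {nF gP hN TT gM LP}.
have : l2norm (v - u) < d.
  have -> : v - u = (v - y) - (u - y) by rewrite opprB addrA subrK.
  by have := l2normB (v - y) (u - y); lra.
apply/negP; rewrite -leNgt; apply: le_trans (ltW dv) _.
rewrite -(@ler_pXn2r _ 2)// ?nnegrE ?l2norm_ge0//.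
rewrite !sqr_l2norm !ipE uv [ip v u]ipC uv.
by have := ip_ge0 u; lra.
Qed.

Section Invariant.
Context (T : l2 R -> l2 R) (F : seq (l2 R)) (c : R).
Hypotheses (cT : compact_operator T) (lT : real_linear T) (sT : ip_symmetric T).
Hypothesis Tinv : forall x, orth F x -> orth F (T x).
Hypothesis eigT :
  forall x mu, orth F x -> x != 0 -> T x = mu *r x -> mu <= c.

(** With [s = sqrt g], [(T - s) (T + s) x = 0]: either [x] is an eigenvector for [- s], or
    [(T + s) x] is one for [s], and then [- s <= s <= c]. *)
Let sqr_eig g x : 0 <= g -> orth F x -> x != 0 -> T (T x) = g *r x ->
  - Num.sqrt g <= c.
Proof.
move=> g0 Fx x0 TTx; pose s := Num.sqrt g.
have ss : s * s = g by rewrite -expr2 sqr_sqrtr.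
have [z0|z0] := eqVneq (T x + s *r x) 0.
  apply: (eigT Fx x0); apply/eqP; rewrite -subr_eq0 -/s rmorphN scaleNr opprK.
  exact/eqP.
have s0 : 0 <= s by exact: sqrtr_ge0.
have: s <= c.
  apply: (eigT _ z0); first by apply: orthD; [exact: Tinv|exact: orthZ].
  rewrite (rlinD lT) (rlinZ lT) TTx scalerDr scalerA -rmorphM ss addrC.
  by [].
by apply: le_trans; rewrite lerNl (le_trans _ s0)// oppr_le0.
Qed.

(* If c = - d < 0, then T ^+ 2 (d ^+ 2 - T ^+ 2) has no positive eigenvalue, so
   its form is nonpositive and |T y| >= d |y| for y in the range of T; as T is
   injective on the complement of F, this contradicts compactness. *)
Lemma compact_eig_bound_ge0 : 0 <= c.
Proof.
rewrite leNgt; apply/negP => c0; pose d := - c;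
  have d0 : 0 < d by rewrite oppr_gt0.
have no_eig g x : 0 <= g -> g < d ^+ 2 -> orth F x -> x != 0 -> T (T x) <> g *r
  x.
  move=> g0 gd Fx x0 /(sqr_eig g0 Fx x0); rewrite lerNl -/d; apply/negP.
  by rewrite -ltNge -(ltr_pXn2r (isT : (0 < 2)%N)) ?nnegrE ?sqrtr_ge0 ?(ltW
    d0)// sqr_sqrtr.
have [B BE] : exists B, forall x, B x = T (T (d ^+ 2 *r x - T (T x))).
  by exists (fun x => T (T (d ^+ 2 *r x - T (T x)))).
have BE' x : B x = d ^+ 2 *r T (T x) - T (T (T (T x))).
  by rewrite BE !(rlinB lT) !(rlinZ lT).
have lB : real_linear B.
  move=> a x y; rewrite !BE' !(rlinD lT, rlinZ lT) !scalerDr !scalerN.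
  by rewrite !scalerA [X in X *: T _]mulrC opprD addrACA.
have sB : ip_symmetric B by move=> x y; rewrite !BE' !ipE !sT.
have [C [C0 TC]] := compact_operator_bounded cT lT.
have cB : compact_operator B.
  move=> x [M xM].
  have [|phi [y [hphi h]]] := @cT (fun n => T (d ^+ 2 *r x n - T (T (x n)))).
    exists (C * (d ^+ 2 * M + C * (C * M))) => n.
    apply: le_trans (TC _) _; apply: ler_wpM2l => //.
    apply: le_trans (l2normB _ _) _; rewrite l2normZ ger0_norm ?sqr_ge0//.
    apply: lerD; first by apply: ler_wpM2l; rewrite ?sqr_ge0.
    apply: le_trans (TC _) _; apply: ler_wpM2l => //.
    by apply: le_trans (TC _) _; apply: ler_wpM2l.
  exists phi, y; split; first exact: hphi.
  by under eq_cvg do rewrite BE.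
have Binv x : orth F x -> orth F (B x).
  by move=> Fx; rewrite BE; do 2 apply: Tinv; apply: orthB;
    [exact: orthZ|do 2 apply: Tinv].
(* For [mu > 0] the roots [d^2 / 2 + s] and [d^2 / 2 - s] of [t (d^2 - t) = mu] lie strictly between
   0 and [d^2]; they are real because [<z, z> = (d^4 / 4 - mu) <x, x>]. One of them is an eigenvalue
   of [T ^+ 2], which [no_eig] excludes. *)
have eigB x mu : orth F x -> x != 0 -> B x = mu *r x -> mu <= 0.
  move=> Fx x0 Bx; rewrite leNgt; apply/negP => mu0.
  have xx := ip_gt0 x0.
  have [z zE] : exists z, z = T (T x) - (d ^+ 2 / 2) *r x by eexists.
  have zz : ip z z = ((d ^+ 2) ^+ 2 / 4 - mu) * ip x x.
    have : ip (B x) x = mu * ip x x by rewrite Bx ipE.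
    rewrite BE' zE !ipE !sT => E; rewrite mulrBl -E; by field.
  have disc : 0 <= (d ^+ 2) ^+ 2 / 4 - mu.
    by rewrite -(pmulr_lge0 _ xx) -zz ip_ge0.
  pose s := Num.sqrt ((d ^+ 2) ^+ 2 / 4 - mu).
  have s0 : 0 <= s by exact: sqrtr_ge0.
  have ss : s ^+ 2 = (d ^+ 2) ^+ 2 / 4 - mu by rewrite sqr_sqrtr.
  have sd : s < d ^+ 2 / 2.
    rewrite -(ltr_pXn2r (isT : (0 < 2)%N)) ?nnegrE// ?divr_ge0 ?sqr_ge0//.
    by rewrite ss; lra.
  have TTz : T (T z) - (d ^+ 2 / 2) *r z = s ^+ 2 *r x.
    have TE : T (T (T (T x))) = d ^+ 2 *r T (T x) - mu *r x by rewrite -Bx BE'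
      opprB addrC subrK.
    apply: ip_inj => v; rewrite zE !(rlinB lT) !(rlinZ lT) TE ss !ipE.
    by field.
  have Fz : orth F z by rewrite zE; apply: orthB;
    [do 2 apply: Tinv|apply: orthZ].
  have d20 : 0 <= d ^+ 2 by exact: sqr_ge0.
  have [z0|z0] := eqVneq (z - s *r x) 0.
    apply: (@no_eig (d ^+ 2 / 2 + s) x) => //; [lra|lra|].
    move/eqP: z0; rewrite subr_eq0 zE subr_eq => /eqP ->.
    by rewrite rmorphD scalerDl addrC.
  apply: (@no_eig (d ^+ 2 / 2 - s) _ _ _ _ z0); [lra|lra| |].
    by apply: orthB => //; exact: orthZ.
  move/eqP: TTz; rewrite subr_eq => /eqP TTz.
  rewrite !(rlinB lT) !(rlinZ lT) TTz.
  have -> : T (T x) = z + (d ^+ 2 / 2) *r x by rewrite zE subrK.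
  by apply: ip_inj => v; rewrite !ipE; ring.
have Bform x (Fx : orth F x) := compact_form_attained cB lB sB Binv (lexx 0)
  eigB Fx.
have lower x : orth F x -> d * l2norm (T x) <= l2norm (T (T x)).
  move=> Fx; have := Bform x Fx; rewrite mul0r BE' !ipE !sT => h.
  rewrite -(@ler_pXn2r _ 2)// ?nnegrE ?mulr_ge0 ?l2norm_ge0 ?(ltW d0)//.
  by rewrite exprMn !sqr_l2norm !sT -subr_le0.
(* [T x] has to be orthogonal to [G], hence [x] to the image of [G] under [T]. On such [x] the
   bounds [d |T x| <= |T (T x)| <= (d / 2) |T x|] clash. *)
have [G hG] := compact_small cT lT sT (divr_gt0 d0 (ltr0n _ 2)).
have [x x0 /orth_cat[Fx Gx]] := exists_orth (F ++ [seq T y | y <- G]).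
have Tx0 : 0 < l2norm (T x).
  rewrite lt_def l2norm_ge0 andbT; apply/negP => /eqP/l2norm_eq0 Tx.
  by have := eigT Fx x0 (_ : T x = 0 *r x);
    rewrite Tx scale0r leNgt c0 => /(_ erefl).
have GTx : orth G (T x) by move=> y yG; rewrite sT; apply/Gx/map_f.
have := hG _ GTx; have := lower x Fx; nra.
Qed.

Lemma compact_form_le x : orth F x -> ip (T x) x <= c * ip x x.
Proof. exact: compact_form_attained cT lT sT Tinv compact_eig_bound_ge0 eigT x.
  Qed.

End Invariant.
End CompactSpectrum.

(** * Ordered eigenvalues *)

Section ComplexInner.
Context {R : realType}.
Implicit Types (x y z : l2 R) (c : R[i]).

Lemma ip_il x y : ip ('i%C *: x) y = - ip x ('i%C *: y).
Proof.
rewrite -(ipii x) scalerA -expr2 sqr_i scaleN1r.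
by rewrite ipNr opprK.
Qed.

Lemma innerDl x y z : inner (x + y) z = inner x z + inner y z.
Proof. by rewrite !inner_ip !ipDl. Qed.

Lemma innerZl c x y : inner (c *: x) y = c * inner x y.
Proof.
have -> : c *: x = complex.Re c *r x + complex.Im c *r ('i%C *: x).
  rewrite scalerA -scalerDl; congr (_ *: _); case: c => a b.
  by apply/eqP; rewrite eq_complex /=; apply/andP; split; apply/eqP; ring.
rewrite !inner_ip !ipE !ip_il scalerA -expr2 sqr_i scaleN1r ipNr opprK.
by case: c => a b /=; apply/eqP; rewrite eq_complex /=; apply/andP; split;
  apply/eqP; ring.
Qed.

Lemma inner0l y : inner 0 y = 0.
Proof. by rewrite -(scale0r 0) innerZl mul0r. Qed.

Lemma inner_suml I (r : seq I) (P : pred I) (F : I -> l2 R) y :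
  inner (\sum_(i <- r | P i) F i) y = \sum_(i <- r | P i) inner (F i) y.
Proof. by elim/big_rec2: _ => [|i u v _ <-]; rewrite ?inner0l ?innerDl. Qed.

Lemma innerC x y : inner y x = ((inner x y)^*)%C.
Proof. by rewrite !inner_ip /= -ip_il [ip y x]ipC [ip y ('i%C *: x)]ipC. Qed.

Lemma inner_eq0C x y : inner x y = 0 -> inner y x = 0.
Proof. by move=> h; rewrite innerC h conjc0. Qed.

Lemma inner_self x : inner x x = (ip x x)%:C%C.
Proof.
rewrite inner_ip; congr (_ +i* _)%C.
by have := ip_il x x; rewrite ipC => h; lra.
Qed.

Lemma inner_self_eq0 x : inner x x = 0 -> x = 0.
Proof. by rewrite inner_self => -[/ip_eq0]. Qed.

(** Complex orthogonality to [v] amounts to real orthogonality to all [v i] and all ['i *: v i];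
    this list carries complex spans into the real setting of [orth]. *)
Definition real_span_family n (v : 'I_n -> l2 R) : seq (l2 R) :=
  [seq v i | i <- enum 'I_n] ++ [seq 'i%C *: v i | i <- enum 'I_n].

Lemma orth_real_span_family n (v : 'I_n -> l2 R) x :
  orth (real_span_family v) x <-> forall i, inner x (v i) = 0.
Proof.
split=> [/orth_cat[h1 h2] i|h].
  rewrite inner_ip h1 ?h2//.
    by apply: (map_f (fun i => 'i%C *: v i)); rewrite mem_enum.
  by apply: map_f; rewrite mem_enum.
apply/orth_cat; split=> _ /mapP[i _ ->]; have := h i; rewrite inner_ip.
  by case.
by case.
Qed.

Lemma self_adjoint_symmetric (T : l2 R -> l2 R) : self_adjoint T -> ip_symmetric
  T.
Proof. by move=> sT x y; have := sT x y; rewrite !inner_ip => -[]. Qed.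

End ComplexInner.

Section Dimension.
Context {R : realType}.
Implicit Types (S : set (l2 R)).

Lemma dim_eq_ge S n : dim_eq S n -> dim_ge S n.
Proof. by move=> [v [lv <-]]; exists v; split. Qed.

Lemma dim_ge_le S m n : (m <= n)%N -> dim_ge S n -> dim_ge S m.
Proof.
move=> mn [v [lv vS]]; exists (fun i => v (widen_ord mn i)).
have ext (c : 'I_m -> R[i]) : exists d : 'I_n -> R[i],
    (forall i, d (widen_ord mn i) = c i) /\
    \sum_i c i *: v (widen_ord mn i) = \sum_i d i *: v i.
  pose d (i : 'I_n) := if insub (val i) is Some k then c k else 0.
  have dw i : d (widen_ord mn i) = c i by rewrite /d valK.
  exists d; split=> //; rewrite [RHS](bigID (fun i : 'I_n => (i < m)%N))/=.
  rewrite [X in _ = _ + X]big1 => [|i im]; last first.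
    by rewrite /d insubF ?scale0r//; apply/negbTE.
  rewrite addr0 (big_ord_narrow mn); apply: eq_bigr => i _.
  by rewrite dw.
split=> [c c0 i|x [c ->]].
  have [d [dw dE]] := ext c; rewrite -dw; apply: lv.
  by rewrite -dE.
by have [d [_ ->]] := ext c; apply: vS; exists d.
Qed.

Lemma dim_ge_eq S m n : dim_ge S m -> dim_eq S n -> (m <= n)%N.
Proof.
move=> [v [lv vS]] [u [_ uS]]; rewrite leqNgt; apply/negP => nm.
have /choice[c cE] i : exists c : 'I_n -> R[i], v i = \sum_j c j *: u j.
  have : spanned u (v i); last by move=> [c ->]; exists c.
  rewrite uS; apply: vS; exists (fun j => (j == i)%:R).
  rewrite (bigD1 i)//= eqxx scale1r big1 ?addr0// => j /negPf ->.
  by rewrite scale0r.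
pose M : 'M[R[i]]_(m, n) := \matrix_(i, j) c i j.
have : kermx M != 0.
  by rewrite kermx_eq0 /row_free neq_ltn (leq_ltn_trans (rank_leq_col _)).
move=> /rowV0Pn[d /sub_kermxP dM /rV0Pn[k /eqP]]; apply.
apply: (lv (fun i => d 0 i)).
under eq_bigr do rewrite cE scaler_sumr.
rewrite exchange_big /= big1// => j _.
under eq_bigr do rewrite scalerA.
rewrite -scaler_suml; have := congr1 (fun N : 'rV_n => N 0 j) dM.
rewrite !mxE => dM0; rewrite (_ : \sum_i _ = 0) ?scale0r//.
by rewrite -[RHS]dM0; apply: eq_bigr => i _; rewrite mxE.
Qed.

End Dimension.

Section Eigenvalues.
Context {R : realType}.
Context (T : {linear l2 R -> l2 R}).
Implicit Types (x : l2 R) (mu : R).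

Let geR : rel R := fun p q : R => q <= p.

Let geR_trans : transitive geR.
Proof. by move=> q p r qp rq; apply: le_trans qp. Qed.

Lemma gen_eigenspace_eigenvector x mu : T x = mu *r x -> gen_eigenspace T mu x.
Proof. by move=> Tx; exists 1%N; rewrite /= Tx subrr. Qed.

(** The eigenvector is the last nonzero iterate of [T - mu] on [x]. *)
Lemma exists_eigenvector x mu : x != 0 -> gen_eigenspace T mu x ->
  exists2 y, y != 0 & T y = mu *r y.
Proof.
move=> + [n]; elim: n x => [|n IHn] x x0; first by move=> /= xE;
  rewrite xE eqxx in x0.
rewrite iterSr; have [|Tx] := eqVneq (T x - mu *r x) 0; last exact: IHn.
by move/eqP; rewrite subr_eq0 => /eqP Tx _; exists x.
Qed.

Lemma dim_ge_orthogonal_eigenvectors (es : seq (l2 R)) mu :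
  (forall e, e \in es -> e != 0 /\ T e = mu *r e) ->
  pairwise (fun x y => inner x y == 0) es ->
  dim_ge (gen_eigenspace T mu) (size es).
Proof.
move=> he /(pairwiseP 0) orth_es; exists (fun i => es`_i);
  split=> [c c0 k|x [c ->]].
  have kes : es`_k \in es by rewrite mem_nth.
  have := congr1 (fun x => inner x es`_k) c0; rewrite inner0l inner_suml.
  rewrite (bigD1 k)//= big1 ?addr0 => [|i ik].
    rewrite innerZl => /eqP;
      rewrite mulf_eq0 => /orP[/eqP//|/eqP/inner_self_eq0 e0].
    by have [] := he _ kes; rewrite e0 eqxx.
  rewrite innerZl; apply/eqP; rewrite mulf_eq0; apply/orP; right.
  have : nat_of_ord i != k by [].
  rewrite neq_ltn => /orP[|] ik'; first by apply: orth_es; rewrite ?inE.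
  by apply/eqP/inner_eq0C/eqP; apply: orth_es; rewrite ?inE.
apply: gen_eigenspace_eigenvector; rewrite linear_sum scaler_sumr.
apply: eq_bigr => i _; rewrite linearZ /= (he es`_i _).2 ?mem_nth//.
by rewrite !scalerA mulrC.
Qed.

(** If [mu < mu'], every entry of [t'] exceeds [mu], so [t] lists it with full multiplicity, hence
    at least as often as [t'] does. Then [t'] fits among the entries of [t] that are at least [mu'];
    the last entry [mu] is not one of them, so [t'] has at most [j - 1] entries. *)
Lemma is_jth_eigenvalue_le j mu mu' :
  is_jth_eigenvalue T j mu -> is_jth_eigenvalue T j mu' -> mu' <= mu.
Proof.
move=> [s [st sort_t dim_gt _]] [s' [st' sort_t' dim_gt' dim_mu']].
rewrite leNgt; apply/negP => lt_mu.
set t := rcons s mu in st sort_t dim_gt.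
set t' := rcons s' mu' in st' sort_t' dim_gt' dim_mu'.
have ge_mu' (x : R) : x \in t' -> mu' <= x.
  move: sort_t'; rewrite (sorted_pairwise geR_trans) pairwise_rcons =>
    /andP[/allP h _].
  by rewrite mem_rcons inE => /predU1P[->|/h].
have cnt (x : R) : (count_mem x t' <= count_mem x [seq p <- t | (mu' <=
  p)%R])%N.
  rewrite count_filter.
  have [mx|mx] := leP mu' x; last first.
    rewrite (_ : count_mem x t' = 0%N)//; apply/count_memPn.
    by apply/negP => /ge_mu'; rewrite leNgt mx.
  have -> : count (predI (pred1 x) (fun p => mu' <= p)) t = count_mem x t.
    by apply: eq_count => y /=; case: eqP => // ->; rewrite mx.
  apply: (@dim_ge_eq _ (gen_eigenspace T x));
    last exact/dim_gt/(lt_le_trans lt_mu).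
  by move: mx; rewrite le_eqVlt => /predU1P[<-//|/dim_gt'/dim_eq_ge].
have /count_subseqP[u /size_subseq us /perm_size tu] := cnt.
have : (size t' <= size s)%N.
  rewrite tu (leq_trans us)// size_filter /t -cats1 count_cat /= leNgt lt_mu
    !addn0.
  exact: count_size.
by rewrite st' -st size_rcons ltnn.
Qed.

Lemma is_jth_eigenvalue_inj j mu mu' :
  is_jth_eigenvalue T j mu -> is_jth_eigenvalue T j mu' -> mu = mu'.
Proof.
by move=> h h'; apply/eqP; rewrite eq_le !(@is_jth_eigenvalue_le j).
Qed.

Lemma lambdaP j : has_jth_eigenvalue T j -> is_jth_eigenvalue T j (lambda j T).
Proof. by move=> [mu h]; apply: xgetPex; exists mu. Qed.

Lemma lambdaE j mu : is_jth_eigenvalue T j mu -> lambda j T = mu.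
Proof. by move=> h; apply: is_jth_eigenvalue_inj (h); apply: lambdaP;
  exists mu. Qed.

(** Each nonempty prefix of the list for [j] is a valid list for its own length, with its last entry
    as the eigenvalue; so one list carries all of [lambda 1 T, ..., lambda j T]. *)
Lemma lambda_list j : has_jth_eigenvalue T j ->
  exists t, [/\ size t = j, t = [seq lambda i.+1 T | i <- iota 0 j],
    sorted (fun p q : R => q <= p) t,
    forall nu, lambda j T < nu -> dim_eq (gen_eigenspace T nu) (count_mem nu t)
      &
    dim_ge (gen_eigenspace T (lambda j T)) (count_mem (lambda j T) t)].
Proof.
move=> /lambdaP[s]; set mu := lambda j T;
  set t := rcons s mu => -[st sort_t dim_gt dim_mu].
exists t; split=> //; apply: (@eq_from_nth _ 0) => [|i it];
  first by rewrite size_map size_iota.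
rewrite st in it; rewrite (nth_map 0%N) ?size_iota// nth_iota//;
  apply/esym/lambdaE.
set ti := nth 0 t i.
have tE : t = take i.+1 t ++ drop i.+1 t by rewrite cat_take_drop.
have ge_mu (x : R) : x \in t -> mu <= x.
  move: sort_t; rewrite (sorted_pairwise geR_trans) pairwise_rcons =>
    /andP[/allP h _].
  by rewrite mem_rcons inE => /predU1P[->|/h].
have mu_ti : mu <= ti by apply/ge_mu/mem_nth; rewrite st.
have takeE : take i.+1 t = rcons (take i t) ti by rewrite (take_nth 0) ?st.
have le_ti (x : R) : x \in drop i.+1 t -> x <= ti.
  have /allrelP h : allrel geR (rcons (take i t) ti) (drop i.+1 t).
    by move: sort_t; rewrite (sorted_pairwise geR_trans) {1}tE takeE
      pairwise_cat => /and3P[].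
  by apply: h; rewrite mem_rcons mem_head.
have sum_count nu : count_mem nu t = (count_mem nu (take i.+1 t) + count_mem nu
  (drop i.+1 t))%N.
  by rewrite {1}tE count_cat.
exists (take i t); rewrite /= -takeE; split.
- by rewrite size_takel ?st.
- exact: take_sorted.
- move=> nu lt_nu; have := dim_gt nu (le_lt_trans mu_ti lt_nu);
    rewrite sum_count.
  rewrite (_ : count_mem nu (drop _ _) = 0%N) ?addn0//; apply/count_memPn.
  by apply/negP => /le_ti; rewrite leNgt lt_nu.
- apply: (@dim_ge_le _ _ _ (count_mem ti t));
    first by rewrite sum_count leq_addr.
  by move: mu_ti; rewrite le_eqVlt => /predU1P[<-//|/dim_gt/dim_eq_ge].
Qed.

Section FirstEigenvalue.
Hypothesis has1 : has_jth_eigenvalue T 1.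

(** A value above [lambda 1 T] has count 0 in the one-element list, so its generalized eigenspace
    has dimension 0. *)
Lemma eigenvalue_le_lambda1 x mu : x != 0 -> T x = mu *r x -> mu <= lambda 1 T.
Proof.
move=> x0 Tx; have [t [st tE _ dim_gt _]] := lambda_list has1.
rewrite leNgt; apply/negP => lt_mu.
have := dim_gt mu lt_mu; rewrite tE /= (lt_eqF lt_mu) /= => -[v [_ vE]].
have := gen_eigenspace_eigenvector Tx; rewrite -vE => -[c];
  rewrite big_ord0 => xE.
by rewrite xE eqxx in x0.
Qed.

Lemma lambda1_eigenvector : exists2 x, ip x x = 1 & T x = lambda 1 T *r x.
Proof.
have [t [_ tE _ _]] := lambda_list has1; rewrite tE /= eqxx => -[v [lv vS]].
have v0 : v ord0 != 0.
  apply/negP => /eqP v0; have := lv (fun=> 1); rewrite big_ord1 v0 scaler0.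
  by move=> /(_ erefl ord0)/eqP; rewrite oner_eq0.
have [|x x0 Tx] := @exists_eigenvector _ (lambda 1 T) v0.
  by apply: vS; exists (fun=> 1); rewrite big_ord1 scale1r.
exists ((l2norm x)^-1 *r x); first exact: l2normalize.
by rewrite linearZ /= Tx !scalerA mulrC.
Qed.

Hypotheses (cT : compact_operator T) (sT : self_adjoint T).

Let rT : real_linear T.
Proof. by move=> a x y; rewrite linearP. Qed.

Lemma rayleigh_le_lambda1 x : ip (T x) x <= lambda 1 T * ip x x.
Proof.
apply: (@compact_form_le _ T [::]) => //; first exact: self_adjoint_symmetric.
by move=> y mu _; exact: eigenvalue_le_lambda1.
Qed.

(** If [mu] lay in the window it would be some [lambda i.+1 T] with [i < l], and [x] together with
    the [v i] for that value would be one eigenvector more than the list counts. Above [lambda l T]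
    this contradicts full multiplicity; at [lambda l T] it produces an eigenvalue number [l + 1]
    inside the window, against the choice of [l]. *)
Lemma leading_complement_eigenvalue eps l (v : 'I_l -> l2 R) x mu :
  leading_eigenvectors T eps v -> (forall i, inner x (v i) = 0) -> x != 0 ->
  T x = mu *r x -> mu < lambda 1 T - eps.
Proof.
move=> [ortho_v eig_v window eig_window] xv x0 Tx; rewrite ltNge; apply/negP.
rewrite lerBlDr -lerBlDl => win_mu.
have [i0 muE] : exists i : 'I_l, mu = lambda i.+1 T by apply: eig_window => //;
  exists x.
have l0 : (0 < l)%N by apply: leq_ltn_trans (ltn_ord i0).
have lord : (l.-1 < l)%N by rewrite prednK.
have [hasl _] := eig_v (Ordinal lord); rewrite /= prednK// in hasl.
have [t [st tE sort_t dim_gt dim_ge]] := lambda_list hasl.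
pose es := x :: map v [seq i : 'I_l <- enum 'I_l | lambda i.+1 T == mu].
have size_es : size es = (count_mem mu t).+1.
  rewrite /= size_map size_filter tE count_map -val_enum_ord count_map.
  by [].
have dim_es : Defs.dim_ge (gen_eigenspace T mu) (count_mem mu t).+1.
  rewrite -size_es; apply: dim_ge_orthogonal_eigenvectors.
    move=> e; rewrite inE => /orP[/eqP ->//|/mapP[i + ->]].
    rewrite mem_filter => /andP[/eqP li _]; split;
      last by rewrite (eig_v i).2 li.
    apply/negP => /eqP vi0; have := ortho_v i i; rewrite vi0 inner0l eqxx.
    by move/esym/eqP; rewrite oner_eq0.
  rewrite /= all_map; apply/andP; split.
    by apply/allP => i _ /=; rewrite xv.
  rewrite pairwise_map;
    apply: sub_pairwise (_ : pairwise (fun i j => i != j) _).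
    by move=> i j /negPf ij; rewrite /= ortho_v ij.
  by rewrite -uniq_pairwise filter_uniq// enum_uniq.
have mu_t : mu \in t.
  by rewrite tE muE; apply: (map_f (fun i => lambda i.+1 T));
    rewrite mem_iota add0n ltn_ord.
have lastE : t = rcons [seq lambda i.+1 T | i <- iota 0 l.-1] (lambda l T).
  by rewrite tE -{1}(prednK l0) -addn1 iotaD add0n map_cat /= prednK// cats1.
have : lambda l T <= mu.
  move: sort_t mu_t; rewrite (sorted_pairwise geR_trans) lastE pairwise_rcons =>
    /andP[/allP h _].
  by rewrite mem_rcons inE => /predU1P[->|/h].
rewrite le_eqVlt => /predU1P[lE|/dim_gt h]; last first.
  by have := dim_ge_eq dim_es h; rewrite ltnn.
have jl : is_jth_eigenvalue T l.+1 mu.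
  exists t; split.
  - by rewrite size_rcons st.
  - move: sort_t; rewrite -lE lastE !(sorted_pairwise geR_trans) => h.
    rewrite pairwise_rcons h andbT all_rcons {1}/geR lexx /=.
    by move: h; rewrite pairwise_rcons => /andP[].
  - move=> nu nu_mu; rewrite -cats1 count_cat /= (lt_eqF nu_mu) !addn0;
      apply: dim_gt.
    by rewrite lE.
  - by rewrite -cats1 count_cat /= eqxx addn0 addn1.
have /(window l.+1 (ltn0Sn _)) : has_jth_eigenvalue T l.+1 by exists mu.
by rewrite (lambdaE jl) => /iffLR/(_ win_mu); rewrite ltnn.
Qed.

(** The complement of the leading eigenvectors is invariant, and [leading_complement_eigenvalue]
    bounds its eigenvalues. Both conclusions are then instances of the facts on compact operators in
    finite codimension. *)
Lemma leading_complement_form eps l (v : 'I_l -> l2 R) :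
  leading_eigenvectors T eps v ->
  0 <= lambda 1 T - eps /\
  forall x, (forall i, inner x (v i) = 0) ->
    ip (T x) x <= (lambda 1 T - eps) * ip x x.
Proof.
move=> lead; have sT' := self_adjoint_symmetric sT.
have Tinv x : orth (real_span_family v) x -> orth (real_span_family v) (T x).
  move=> Fx y yF; rewrite sT'.
  suff [mu ->] : exists mu, T y = mu *r y by rewrite ipZr Fx// mulr0.
  have [_ eig_v _ _] := lead.
  move: yF; rewrite mem_cat => /orP[/mapP[i _ ->]|/mapP[i _ ->]].
    by have [_ ->] := eig_v i; eexists.
  exists (lambda i.+1 T); rewrite linearZ /= (eig_v i).2.
  by rewrite !scalerA mulrC.
have eig x mu : orth (real_span_family v) x -> x != 0 -> T x = mu *r x ->
    mu <= lambda 1 T - eps.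
  move=> /orth_real_span_family Fx x0 Tx.
  by apply: ltW; exact: leading_complement_eigenvalue lead Fx x0 Tx.
split; first exact: compact_eig_bound_ge0 cT rT sT' Tinv eig.
move=> x /orth_real_span_family; exact: compact_form_le.
Qed.

End FirstEigenvalue.
End Eigenvalues.

(** * Compressions *)

Section Compression.
Context {R : realType}.
Local Open Scope sesquilinear_scope.

Lemma innerZr c (x y : l2 R) : inner x (c *: y) = (c^*)%C * inner x y.
Proof. by rewrite innerC innerZl rmorphM /= -innerC. Qed.

Lemma inner_sumr I (r : seq I) (P : pred I) (F : I -> l2 R) (x : l2 R) :
  inner x (\sum_(i <- r | P i) F i) = \sum_(i <- r | P i) inner x (F i).
Proof.
by rewrite innerC inner_suml rmorph_sum; apply: eq_bigr => i _;
  rewrite /= -innerC.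
Qed.

Lemma conjcE (z : R[i]) : (z^*)%C = Num.conj z.
Proof. by []. Qed.

Context (T : {linear l2 R -> l2 R}) (m : nat) (V : 'I_m -> l2 R).
Hypotheses (sT : self_adjoint T) (oV : orthonormal_family V) (m0 : (0 < m)%N).

Let M := compression V T.

Let hermM : M \is hermsymmx.
Proof.
apply/is_hermitianmxP; rewrite expr0 scale1r; apply/matrixP => i j.
by rewrite !mxE -conjcE -innerC sT.
Qed.

(* The conjugate matches the left action of 'M on rows used by eigenvalue *)
Let vec (r : 'rV[R[i]]_m) : l2 R := \sum_i Num.conj (r 0 i) *: V i.

Let spanned_vec x : spanned V x <-> exists r, x = vec r.
Proof.
split=> [[c ->]|[r ->]]; last by exists (fun i => Num.conj (r 0 i)).
exists (\row_i Num.conj (c i)); apply: eq_bigr => i _.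
by rewrite mxE conjCK.
Qed.

Let inner_T_vec r : inner (T (vec r)) (vec r) = (r *m M *m r ^t*) 0 0.
Proof.
rewrite /vec linear_sum inner_suml !mxE; apply: eq_bigr => j _.
rewrite inner_sumr linearZ /= !mxE mulr_suml; apply: eq_bigr => i _.
rewrite innerZr innerZl !mxE conjcE conjCK.
by rewrite mulrCA mulrC.
Qed.

Let inner_vec r : inner (vec r) (vec r) = (r *m r ^t*) 0 0.
Proof.
rewrite /vec inner_suml mxE; apply: eq_bigr => j _.
rewrite innerZl inner_sumr (bigD1 j)//= big1 ?addr0 => [|i ij].
  by rewrite innerZr oV eqxx mulr1 conjcE conjCK !mxE mulrC.
by rewrite innerZr oV eq_sym (negPf ij) mulr0.
Qed.

Let P := spectralmx M.
Let D := spectral_diag M.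
Let d i := complex.Re (D 0 i).

Let dE i : D 0 i = (d i)%:C%C.
Proof.
have /mxOverP/(_ 0 i)/CrealP := hermitian_spectral_diag_real hermM.
rewrite /d -/D; case: (D 0 i) => a b; rewrite -conjcE /= => -[bb].
by congr (_ +i* _)%C; lra.
Qed.

Let ME : M = P ^t* *m diag_mx D *m P.
Proof.
have /orthomx_spectralP := hermitian_normalmx hermM.
by rewrite invmx_unitary ?spectral_unitarymx.
Qed.

Let PtP : P ^t* *m P = 1%:M.
Proof. by rewrite -invmx_unitary ?spectral_unitarymx// mulVmx ?spectral_unit.
  Qed.

Let PPt : P *m P ^t* = 1%:M.
Proof. by rewrite -invmx_unitary ?spectral_unitarymx// mulmxV ?spectral_unit.
  Qed.

Let eigenvalue_d (a : R) : eigenvalue M a%:C%C <-> exists i, a = d i.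
Proof.
split=> [/eigenvalueP[r rM r0]|[i ->]].
  pose e := r *m P ^t*.
  have : e != 0.
    by apply: contra r0 => /eqP e0;
      rewrite -[r]mulmx1 -PtP mulmxA -/e e0 mul0mx.
  have eM : e *m diag_mx D = a%:C%C *: e.
    have : r *m M *m P ^t* = a%:C%C *: e by rewrite rM scalemxAl.
    by rewrite ME !mulmxA -[_ *m P *m _]mulmxA PPt mulmx1.
  clearbody e; move=> /rV0Pn[i ei]; exists i;
    have := congr1 (fun N : 'rV_m => N 0 i) eM.
  rewrite mul_mx_diag !mxE dE mulrC => /(mulIf ei) [->].
  by [].
apply/eigenvalueP; exists (row i P).
  rewrite ME !mulmxA -row_mul PPt row1 -[delta_mx _ _ *m _]rowE row_diag_mx dE.
  by rewrite -scalemxAl -rowE.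
apply/negP => /eqP Pi; have := congr1 (fun N => row i N) PPt.
rewrite row_mul Pi mul0mx => /rowP/(_ i); rewrite !mxE eqxx => /eqP.
by rewrite eq_sym oner_eq0.
Qed.

(** The unitary [P] diagonalizes [M]: in the rotated coordinates [e] the form is the sum of the
    [d i |e_i|^2], and [lambda_max_mx] is the largest weight. *)
Lemma lambda_max_compression :
  (forall z, spanned V z ->
     ip (T z) z <= lambda_max_mx (compression V T) * ip z z) /\
  exists z, [/\ spanned V z, z != 0 &
     ip (T z) z = lambda_max_mx (compression V T) * ip z z].
Proof.
rewrite -/M; set l := lambda_max_mx M.
have [lM lmax] : eigenvalue M l%:C%C /\ forall nu : R, eigenvalue M nu%:C%C ->
  nu <= l.
  (* [0 < m] supplies an index to maximize over, so the default 0 of [xget] is not what is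
     returned. *)
  pose i0 := [arg max_(i > Ordinal m0) d i]%O.
  apply: (@xgetPex _ 0 [set mu : R | eigenvalue M mu%:C%C /\
                       forall nu : R, eigenvalue M nu%:C%C -> nu <= mu]).
  exists (d i0); split; first by apply/eigenvalue_d; exists i0.
  move=> nu /eigenvalue_d[i ->]; rewrite /i0.
  by case: arg_maxP => // j _; apply.
split=> [z /spanned_vec[r ->]|].
  have -> : ip (T (vec r)) (vec r) = complex.Re (inner (T (vec r)) (vec r)) by
    [].
  have -> : ip (vec r) (vec r) = complex.Re (inner (vec r) (vec r)) by [].
  rewrite inner_T_vec inner_vec; pose e := r *m P ^t*.
  have eE : e ^t* = P *m r ^t* by rewrite /e trmx_mul map_mxM trmxCK.
  have -> : r *m M *m r ^t* = e *m diag_mx D *m e ^t*.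
    by rewrite eE ME /e !mulmxA.
  have -> : r *m r ^t* = e *m e ^t*.
    by rewrite eE /e !mulmxA -[r *m _ *m P]mulmxA PtP mulmx1.
  clearbody e.
  rewrite mul_mx_diag !mxE !raddf_sum /= mulr_sumr; apply: ler_sum => k _.
  rewrite !mxE dE -conjcE; case: (e 0 k) => p q /=.
  have dk : d k <= l by apply: lmax; apply/eigenvalue_d; exists k.
  rewrite -subr_ge0.
  rewrite [X in 0 <= X](_ : _ = (l - d k) * (p ^+ 2 + q ^+ 2)); last by ring.
  by rewrite mulr_ge0 ?subr_ge0// addr_ge0 ?sqr_ge0.
have /eigenvalueP[r rM r0] := lM.
have eqi : inner (T (vec r)) (vec r) = l%:C%C * inner (vec r) (vec r).
  by rewrite inner_T_vec inner_vec rM -scalemxAl mxE.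
exists (vec r); split; first by apply/spanned_vec; exists r.
- apply/negP => /eqP v0; have := inner_vec r; rewrite v0 inner0l => rr.
  by have := dotmx_is_dotmx r0; rewrite dotmxE -rr ltxx.
- by move: eqi; rewrite inner_self inner_ip => -[-> _]; rewrite mul0r subr0.
Qed.

End Compression.

(** * Differentiability of real functions *)

Section Calculus.
Context {R : realType}.
Implicit Types (f g : R -> R) (x d e : R).

(** First-order Taylor form, free of division by [h]: comparisons between functions pass through it
    as linear inequalities. *)
Definition diff_at f x d := forall e, 0 < e ->
  exists2 r, 0 < r & forall h, `|h| < r -> `|f (x + h) - f x - h * d| <= e *
    `|h|.

Lemma diff_at_is_derive f x d : diff_at f x d <-> is_derive x 1 f d.
Proof.
split=> [fd|[df fd] e e0].
  have lim : h^-1 *: (f (h *: 1 + x) - f x) @[h --> 0^'] --> d.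
    apply/cvgrPdist_le => e e0; have [r r0 fr] := fd e e0.
    apply/nbhs_ballP; exists r => //= h; rewrite /ball /= sub0r normrN => hr h0.
    have := fr h hr; rewrite -[h *: 1]/(h * 1) mulr1 [h + x]addrC => H.
    rewrite -(ler_pM2r (_ : 0 < `|h|)) ?normr_gt0// -normrM.
    apply: le_trans H; rewrite -normrN mulrBl opprB.
    by rewrite -[_^-1 *: _]/(_^-1 * _) mulrAC mulVf// mul1r mulrC.
  by split; [apply/cvg_ex; exists d|exact/cvg_lim].
have lim : h^-1 *: (f (h *: 1 + x) - f x) @[h --> 0^'] --> d.
  by rewrite -fd; exact: df.
move/cvgrPdist_le : lim => /(_ e e0)/nbhs_ballP[r /= r0 fr];
  exists r => // h hr.
have [->|h0] := eqVneq h 0;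
  first by rewrite addr0 mul0r subrr subr0 normr0 mulr0.
have := fr h; rewrite /ball /= sub0r normrN => /(_ hr h0).
rewrite -[h *: 1]/(h * 1) mulr1 [h + x]addrC -[_^-1 *: _]/(_^-1 * _) => H.
have -> : f (x + h) - f x - h * d = - (d - h^-1 * (f (x + h) - f x)) * h.
  by rewrite mulNr mulrBl mulrAC mulVf// mul1r opprB [d * h]mulrC.
by rewrite normrM normrN ler_pM2r ?normr_gt0.
Qed.

Lemma diff_at_derive1 f x : derivable f x 1 -> diff_at f x (derive1 f x).
Proof. by move=> df; apply/diff_at_is_derive; rewrite derive1E;
  exact: derivableP. Qed.

Lemma diff_at_derivable f x d : diff_at f x d -> derivable f x 1 /\ derive1 f x
  = d.
Proof. by move=> /diff_at_is_derive[df fd]; rewrite derive1E. Qed.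

Lemma diff_at_sum I (s : seq I) (f : I -> R -> R) (d c : I -> R) x :
  (forall i, diff_at (f i) x (d i)) ->
  diff_at (fun y => \sum_(i <- s) f i y * c i) x (\sum_(i <- s) d i * c i).
Proof.
move=> fd; elim: s => [|i s IHs] e e0.
  by exists 1 => // h _;
    rewrite !big_nil subrr mulr0 subr0 normr0 mulr_ge0// ltW.
have e2 : 0 < e / 2 by rewrite divr_gt0.
have [r1 r10 h1] := IHs _ e2.
have c1 : 0 < `|c i| + 1 by rewrite ltr_wpDl.
have [r2 r20 h2] := fd i _ (divr_gt0 e2 c1).
exists (Num.min r1 r2); first by rewrite lt_min r10.
move=> h; rewrite lt_min => /andP[/h1 H1 /h2 H2]; rewrite !big_cons.
set S := \sum_(j <- s) _ in H1 *; set S' := \sum_(j <- s) _ in H1 *.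
set D := \sum_(j <- s) _ in H1 *.
rewrite (_ : _ - _ = (f i (x + h) - f i x - h * d i) * c i + (S - S' - h * D));
  last by ring.
apply: le_trans (ler_normD _ _) _; rewrite normrM [e]splitr mulrDl lerD//.
apply: le_trans (ler_wpM2r (normr_ge0 _) H2) _.
rewrite mulrAC ler_wpM2r// mulrAC -mulrA ler_piMr ?(ltW e2)// ler_pdivrMr//.
by rewrite mul1r lerDl.
Qed.

(** [f - g] has a local minimum at [x]. This is how a Rayleigh quotient touching [lambda_1] from
    below determines its derivative. *)
Lemma diff_at_minorant f g x d d' : diff_at f x d -> diff_at g x d' -> g x = f x
  ->
  (exists2 r, 0 < r & forall h, `|h| < r -> g (x + h) <= f (x + h)) -> d = d'.
Proof.
move=> fd gd gf [r r0 le_gf]; apply/eqP; rewrite -subr_eq0 -normr_le0.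
apply/ler_addgt0Pr => e e0; rewrite add0r.
have e2 : 0 < e / 2 by rewrite divr_gt0.
have [r1 r10 h1] := fd _ e2; have [r2 r20 h2] := gd _ e2.
pose t := Num.min r (Num.min r1 r2) / 2.
have t0 : 0 < t by rewrite divr_gt0// !lt_min r0 r10.
have tm : t < Num.min r (Num.min r1 r2) by rewrite ltr_pdivrMr// ltr_pMr
  ?ltr1n// !lt_min r0 r10.
move: tm; rewrite !lt_min => /and3P[tr tr1 tr2].
have key h : `|h| = t -> h * (d' - d) <= e * t.
  move=> ht; have := h1 h; have := h2 h; have := le_gf h; rewrite ht.
  move=> /(_ tr) + /(_ tr2) + /(_ tr1);
    rewrite gf !ler_norml => A /andP[B1 B2] /andP[C1 C2].
  nra.
have k1 := key t (gtr0_norm t0); have := key (- t);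
  rewrite normrN gtr0_norm// => /(_ erefl) k2.
by rewrite ler_norml; apply/andP; split; rewrite -(ler_pM2l t0); nra.
Qed.

Lemma diff_at_squeeze f g u x d : diff_at f x d -> diff_at g x d ->
  f x = u x -> g x = u x ->
  (exists2 r, 0 < r & forall h, `|h| < r -> f (x + h) <= u (x + h) <= g (x + h))
    ->
  diff_at u x d.
Proof.
move=> fd gd fu gu [r r0 H] e e0.
have [r1 r10 h1] := fd _ e0; have [r2 r20 h2] := gd _ e0.
exists (Num.min r (Num.min r1 r2)); first by rewrite !lt_min r0 r10.
move=> h; rewrite !lt_min => /and3P[/H/andP[A B] /h1 + /h2].
by rewrite fu gu !ler_norml => /andP[C D] /andP[E F]; apply/andP; split; lra.
Qed.

Let series_shift (u : nat -> R) : cvgn (series u) -> cvgn (series (fun n => u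
  n.+1)).
Proof.
move=> cu; have -> : series (fun n => u n.+1) = (fun n => series u n.+1 - u
  0%N).
  apply/funext => n; rewrite /series /= big_nat_recl//= addrAC subrr add0r.
  by [].
apply: is_cvgB; last exact: is_cvg_cst.
by apply/cvg_ex; exists (limn (series u)); rewrite (cvg_shiftS (series u)).
Qed.

Let mean_value_pow (p q : R) n : 0 <= p -> p <= q ->
  n.+1%:R * p ^+ n * (q - p) + p ^+ n.+1 <= q ^+ n.+1.
Proof.
move=> p0 pq; elim: n => [|n IHn].
  by rewrite !expr1 expr0 mulr1 mul1r subrK.
rewrite [q ^+ _]exprS; have q0 : 0 <= q by apply: le_trans pq.
apply: le_trans (ler_wpM2l q0 IHn).
rewrite [n.+2%:R]mulrSr [p ^+ n.+2]exprS !exprS; set N := n.+1%:R;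
  set P := p ^+ n.
have P0 : 0 <= P by exact: exprn_ge0.
have N0 : 0 <= N by exact: ler0n.
have : 0 <= N * P * (q - p) * (q - p) by rewrite !mulr_ge0// subr_ge0.
by rewrite -subr_ge0 => h; rewrite -subr_ge0; apply: le_trans h _;
  rewrite le_eqVlt; apply/orP; left; apply/eqP; ring.
Qed.

(** With [y] halfway between [|x|] and [|K|], [mean_value_pow] bounds [(n + 1) |x|^n] by
    [y^(n+1) / (y - |x|)], and the series of [|a n|] converges at [y]. *)
Lemma is_cvg_pseries_diffs (a : R^nat) (K x : R) : cvgn (pseries a K) ->
  `|x| < `|K| -> cvgn (pseries (pseries_diffs a) x).
Proof.
move=> cK xK; apply: normed_cvg; pose y := (`|x| + `|K|) / 2.
have xy : `|x| < y by rewrite ltr_pdivlMr// mulrDr mulr1 ltrD2l.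
have yK : y < `|K| by rewrite ltr_pdivrMr// mulrDr mulr1 ltrD2r.
have y0 : 0 <= y by apply: le_trans (ltW xy).
have cy : cvgn (pseries (fun i => `|a i|) y).
  by apply: is_cvg_pseries_inside_norm cK _; rewrite ger0_norm.
have cs := @is_cvg_seriesZ _ _ (y - `|x|)^-1 (series_shift cy).
apply: (series_le_cvg _ _ _ cs) => [n|n|n] /=.
- exact: normr_ge0.
- by rewrite /= mulr_ge0 ?invr_ge0 ?subr_ge0 ?(ltW xy)// mulr_ge0// exprn_ge0.
- rewrite [leRHS]/((y - `|x|)^-1 * (`|a n.+1| * y ^+ n.+1)) [leRHS]mulrC.
  rewrite /pseries_diffs !normrM normr_nat normrX ler_pdivlMr ?subr_gt0//.
  have := mean_value_pow n (normr_ge0 x) (ltW xy); rewrite -lerBrDr => h.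
  have := ler_wpM2l (normr_ge0 (a n.+1)) h.
  set A := `|a _|; set X := `|x| ^+ n; set Y := `|x| ^+ n.+1 => h'.
  apply: (le_trans (y := A * (y ^+ n.+1 - Y))); last first.
    by rewrite ler_wpM2l ?normr_ge0// gerBl exprn_ge0.
  by apply: le_trans h'; rewrite le_eqVlt; apply/orP; left; apply/eqP; ring.
Qed.

Lemma real_analytic_C1 (U : set R) f c : real_analytic_on U f -> U c ->
  (\forall x \near c, derivable f x 1) /\ {for c, continuous (derive1 f)}.
Proof.
move=> fU Uc; have [a /nbhs_ballP[r /= r0 fa]] := fU c Uc.
pose K := r / 2; have K0 : 0 < K by rewrite divr_gt0.
have cvg0 : cvgn (pseries a K).
  have := fa (c + K); rewrite /ball /= opprD addrA subrr sub0r normrN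
    gtr0_norm//.
  have -> : c + K - c = K by rewrite addrC addKr.
  by rewrite ltr_pdivrMr// ltr_pMr// ltr1n => /(_ isT) h; apply/cvg_ex;
    exists (f (c + K)).
have step (b : R^nat) L : 0 < L -> cvgn (pseries b L) -> cvgn (pseries
  (pseries_diffs b) (L / 2)).
  move=> L0 h; apply: is_cvg_pseries_diffs h _.
  by rewrite !gtr0_norm ?divr_gt0// ltr_pdivrMr// ltr_pMr// ltr1n.
have smaller (b : R^nat) L k : 0 < L -> cvgn (pseries b L) -> 1 < k -> cvgn
  (pseries b (L / k)).
  move=> L0 h k1; apply: is_cvg_pseries_inside h _.
  have k0 : 0 < k by apply: lt_trans k1.
  by rewrite !gtr0_norm ?divr_gt0// ltr_pdivrMr// ltr_pMr.
have K2 : 0 < K / 2 by rewrite divr_gt0.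
have K4 : 0 < K / 2 / 2 by rewrite divr_gt0.
have cvg1 := step _ _ K0 cvg0; have cvg2 := step _ _ K2 cvg1;
  have cvg3 := step _ _ K4 cvg2.
(* [pseries_snd_diffs] asks for a series and its first two formal derivatives. It serves [F] and
   then [G], so three derivatives of [a] are needed, each at half the previous radius. *)
pose L := K / 2 / 2 / 2; have L0 : 0 < L by rewrite divr_gt0.
have gt1_2 : 1 < (2 : R) by rewrite ltr1n.
have c0 : cvgn (pseries a L) by exact: smaller K4 (smaller _ _ _ K2 (smaller _ _
  _ K0 cvg0 gt1_2) gt1_2) gt1_2.
have c1 : cvgn (pseries (pseries_diffs a) L) by exact: smaller K4 (smaller _ _ _
  K2 cvg1 gt1_2) gt1_2.
have c2 : cvgn (pseries (pseries_diffs (pseries_diffs a)) L) by exact: smaller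
  K4 cvg2 gt1_2.
pose F (x : R) : R := limn (pseries a x);
  pose G (x : R) : R := limn (pseries (pseries_diffs a) x).
have FG (y : R) : `|y| < L -> is_derive y 1 F (G y).
  by move=> yL; apply: pseries_snd_diffs c0 c1 c2 _; rewrite [`|L|]gtr0_norm.
have dG : is_derive (0 : R) (1 : R) G (limn (pseries (pseries_diffs
  (pseries_diffs a)) 0)).
  by apply: pseries_snd_diffs c1 c2 cvg3 _; rewrite normr0 gtr0_norm.
have LK : L < r.
  rewrite /L /K; lra.
have fF x : `|x - c| < L -> f x = F (x - c).
  move=> xc; apply/esym/cvg_lim => //; apply: fa; rewrite /ball /= distrC.
  by apply: lt_trans LK.
have fG x : `|x - c| < L -> diff_at f x (G (x - c)).
  move=> xc e e0; have [s s0 hs] := (diff_at_is_derive F (x - c) _).2 (FG _ xc)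
    e e0.
  exists (Num.min s (L - `|x - c|)); first by rewrite lt_min s0 subr_gt0.
  move=> h; rewrite lt_min => /andP[/hs]; rewrite ltrBrDr => H hL.
  have xhL : `|x + h - c| < L.
    by rewrite addrAC addrC; apply: le_lt_trans (ler_normD _ _) _.
  by rewrite (fF _ xc) (fF _ xhL) [x + h - c]addrAC.
have fderiv x : `|x - c| < L -> derivable f x 1 /\ derive1 f x = G (x - c).
  by move=> /fG; exact: diff_at_derivable.
have cG : {for 0, continuous G}.
  by apply: differentiable_continuous; apply/derivable1_diffP; case: dG.
clearbody F G L.
have near_cL : \forall x \near c, `|x - c| < L.
  by apply/nbhs_ballP; exists L; [exact: L0|move=> x; rewrite /ball /= distrC].
split; first by apply: filterS near_cL => x /fderiv[].
have fc : derive1 f c = G 0 by have [|_ ->] := fderiv c; rewrite ?subrr ?normr0.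
have cs : (x - c) @[x --> c] --> (0 : R).
  by rewrite -[X in _ --> X](subrr c); apply: cvgB;
    [exact: cvg_id|exact: cvg_cst].
have : (G \o (fun x => x - c)) x @[x --> c] --> G 0 by exact: (cvg_comp _ _ cs
  cG).
rewrite -fc; apply: cvg_trans; apply: near_eq_cvg.
by apply: filterS near_cL => x /fderiv[_ ->].
Qed.

End Calculus.

(** * Operator pencils *)

Section CompactCombinations.
Context {R : realType}.
Implicit Types (S T : l2 R -> l2 R).

Lemma compact_operator_seqP T :
  compact_operator T <-> forall (x : nat -> l2 R) M, (forall n, l2norm (x n) <=
    M) ->
    exists (phi : nat -> nat) y, {homo phi : m n / (m < n)%N} /\
      forall e, 0 < e -> exists N, forall n, (N <= n)%N ->
        l2norm (T (x (phi n)) - y) < e.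
Proof.
split=> [cT x M|H x [M xM]]; first exact: compact_subseq.
have [phi [y [hphi h]]] := H x M xM; exists phi, y; split; first exact: hphi.
apply/cvgrPdist_lt => e e0; have [N hN] := h e e0; exists N => // n /= /hN.
by rewrite sub0r normrN ger0_norm ?l2norm_ge0.
Qed.

Lemma compact_operator0 : compact_operator (fun=> 0 : l2 R).
Proof.
apply/compact_operator_seqP => x M _; exists id, 0; split=> // e e0.
by exists 0%N => n _; rewrite subrr l2norm0.
Qed.

Lemma compact_operatorD S T : compact_operator S -> compact_operator T ->
  compact_operator (fun x => S x + T x).
Proof.
move=> cS cT; apply/compact_operator_seqP => x M xM.
have [phi [y [hphi hy]]] := compact_subseq cS xM.
have [psi [z [hpsi hz]]] := compact_subseq cT (fun n => xM (phi n)).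
exists (phi \o psi), (y + z); split=> [m n /hpsi/hphi//|e e0].
have e2 : 0 < e / 2 by rewrite divr_gt0.
have [N1 h1] := hy _ e2; have [N2 h2] := hz _ e2.
exists (maxn N1 N2) => n; rewrite geq_max => /andP[n1 n2].
have := h1 _ (leq_trans n1 (homo_ltn_ge hpsi n)); have := h2 _ n2.
rewrite /= opprD addrACA => A B; apply: le_lt_trans (l2normD _ _) _.
by rewrite [e]splitr ltrD.
Qed.

Lemma compact_operatorZ a T : compact_operator T ->
  compact_operator (fun x => a *r T x).
Proof.
move=> cT; apply/compact_operator_seqP => x M xM.
have [phi [y [hphi hy]]] := compact_subseq cT xM.
exists phi, (a *r y); split=> // e e0.
have a1 : 0 < `|a| + 1 by rewrite ltr_wpDl.
have [N hN] := hy _ (divr_gt0 e0 a1); exists N => n /hN.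
rewrite ltr_pdivlMr// => h; rewrite -scalerBr l2normZ.
apply: le_lt_trans h; rewrite mulrC ler_wpM2l ?l2norm_ge0//.
by rewrite lerDl.
Qed.

End CompactCombinations.

Section OpSum.
Context {R : realType} {kappa : nat} (A : 'I_kappa -> {linear l2 R -> l2 R}).
Implicit Types (f : 'I_kappa -> R -> R) (w : R) (x y : l2 R).

Lemma opsum_is_linear f w : linear (opsum f A w).
Proof.
move=> c x y; rewrite /opsum scaler_sumr -big_split /=; apply: eq_bigr => j _.
by rewrite linearP scalerDr !scalerA mulrC.
Qed.

HB.instance Definition _ f w :=
  GRing.isLinear.Build _ _ _ _ (opsum f A w) (opsum_is_linear f w).

Lemma opsum_self_adjoint f w : (forall j, self_adjoint (A j)) ->
  self_adjoint (opsum f A w).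
Proof.
move=> sA x y; rewrite /opsum inner_suml inner_sumr; apply: eq_bigr => j _.
by rewrite innerZl innerZr sA conjc_real.
Qed.

Lemma opsum_compact f w : (forall j, compact_operator (A j)) ->
  compact_operator (opsum f A w).
Proof.
move=> cA; rewrite /opsum.
suff : forall s : seq 'I_kappa,
    compact_operator (fun x => \sum_(j <- s) (f j w)%:C%C *: A j x) by exact.
elim=> [|j s IHs].
  rewrite (_ : (fun x => _) = fun=> 0); first exact: compact_operator0.
  by apply/funext => x; rewrite big_nil.
rewrite (_ : (fun x => _) =
    fun x => f j w *r A j x + \sum_(j <- s) f j w *r A j x).
  exact: compact_operatorD (compact_operatorZ _ (cA j)) IHs.
by apply/funext => x; rewrite big_cons.
Qed.

Lemma ip_opsum f w x y : ip (opsum f A w x) y = \sum_j f j w * ip (A j x) y.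
Proof. by rewrite /opsum ip_suml; apply: eq_bigr => j _; rewrite ipZl. Qed.

Lemma linear_real_linear (T : {linear l2 R -> l2 R}) : real_linear T.
Proof. by move=> a x y; rewrite linearP. Qed.

Hypothesis cA : forall j, compact_operator (A j).

Lemma opsum_bounds : exists B : 'I_kappa -> R, (forall j, 0 <= B j) /\
  forall j x, l2norm (A j x) <= B j * l2norm x.
Proof.
have /choice[B hB] j := compact_operator_bounded (cA j) (linear_real_linear (A
  j)).
by exists B; split=> j; have [] := hB j.
Qed.

(** When [B j] bounds the norm of [A j], this bounds the operator norm of the difference of the
    pencil at [v] and [w]; it has the triangle inequality and tends to 0 with continuous [f]. *)
Definition opdist (B : 'I_kappa -> R) f (v w : R) := \sum_j `|f j v - f j w| * B
  j.

Section Opdist.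
Context (B : 'I_kappa -> R) (f : 'I_kappa -> R -> R).
Hypotheses (B0 : forall j, 0 <= B j)
  (AB : forall j x, l2norm (A j x) <= B j * l2norm x).

Lemma opdistC v w : opdist B f v w = opdist B f w v.
Proof. by apply: eq_bigr => j _; rewrite distrC. Qed.

Lemma opdist_triangle u v w : opdist B f u w <= opdist B f u v + opdist B f v w.
Proof.
rewrite -big_split /=; apply: ler_sum => j _; rewrite -mulrDl ler_wpM2r//.
exact: ler_distD.
Qed.

Lemma opsum_dist v w x :
  l2norm (opsum f A v x - opsum f A w x) <= opdist B f v w * l2norm x.
Proof.
rewrite /opsum /opdist -sumrB mulr_suml.
elim/big_rec2: _ => [|j u z _ h]; first by rewrite l2norm0.
apply: le_trans (l2normD _ _) _; apply: lerD h.
by rewrite -scalerBl -rmorphB l2normZ -mulrA ler_wpM2l.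
Qed.

Lemma ip_opsum_dist v w x y :
  `|ip (opsum f A v x) y - ip (opsum f A w x) y| <=
    opdist B f v w * l2norm x * l2norm y.
Proof.
rewrite -ipNl -ipDl; apply: le_trans (ip_CS _ _) _.
by rewrite ler_wpM2r ?l2norm_ge0// opsum_dist.
Qed.

Lemma near_opdist (c e : R) : (forall j, {for c, continuous (f j)}) -> 0 < e ->
  \forall v \near c, opdist B f v c < e.
Proof.
move=> fc; rewrite /opdist; elim: (index_enum _) e => [|j s IHs] e e0.
  by apply/nbhs_ballP; exists 1; [exact: ltr01|move=> v _; rewrite /= big_nil].
have e2 : 0 < e / 2 by rewrite divr_gt0.
have b1 : 0 < B j + 1 by rewrite ltr_wpDl.
have /cvgrPdist_lt/(_ _ (divr_gt0 e2 b1)) := fc j.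
apply: filterS2 (IHs _ e2) => v h1 h2.
rewrite big_cons [e]splitr ltrD//; move: h2; rewrite ltr_pdivlMr// distrC => h2.
by apply: le_lt_trans h2; rewrite ler_wpM2l// lerDl.
Qed.

End Opdist.
End OpSum.

Section Subspaces.
Context {R : realType}.

Lemma spanned_mem n (v : 'I_n -> l2 R) i : spanned v (v i).
Proof.
exists (fun j => (j == i)%:R);
  rewrite (bigD1 i)//= eqxx scale1r big1 ?addr0// => j /negPf ->.
by rewrite scale0r.
Qed.

Lemma spanned0 n (v : 'I_n -> l2 R) : spanned v 0.
Proof. by exists (fun=> 0); rewrite big1// => i _; rewrite scale0r. Qed.

Lemma subspace0 l (v : forall k, 'I_(l k) -> l2 R) n : Defs.subspace v n 0.
Proof.
elim: n => [|n IHn]; first exact: spanned0.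
by exists 0 => //; exists 0; [exact: spanned0|rewrite addr0].
Qed.

Lemma spanned_subspace l (v : forall k, 'I_(l k) -> l2 R) k n x : (k <= n)%N ->
  spanned (v k) x -> Defs.subspace v n x.
Proof.
elim: n => [|n IHn]; first by rewrite leqn0 => /eqP ->.
rewrite leq_eqVlt => /predU1P[->|kn] vx /=.
  by exists 0; [exact: subspace0|exists x => //; rewrite add0r].
by exists x; [exact: IHn|exists 0; [exact: spanned0|rewrite addr0]].
Qed.

Lemma lambda_max_compression_le (T : {linear l2 R -> l2 R}) m (V : 'I_m -> l2 R)
  :
  compact_operator T -> self_adjoint T -> has_jth_eigenvalue T 1 ->
  orthonormal_family V -> (0 < m)%N ->
  lambda_max_mx (compression V T) <= lambda 1 T.
Proof.
move=> cT sT hasT oV m0;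
  have [_ [z [_ z0 zE]]] := lambda_max_compression sT oV m0.
by rewrite -(ler_pM2r (ip_gt0 z0)) -zE; exact: rayleigh_le_lambda1.
Qed.

Lemma orthogonal_decomposition n (v : 'I_n -> l2 R) u : orthonormal_family v ->
  exists2 q, spanned v (u - q) & forall i, inner q (v i) = 0.
Proof.
move=> ov; exists (u - \sum_i inner u (v i) *: v i).
  by exists (fun i => inner u (v i)); rewrite opprB addrC subrK.
move=> i; rewrite innerDl -scaleN1r innerZl inner_suml (bigD1 i)//= big1 => [|j
  ji].
  by rewrite innerZl ov eqxx mulr1 addr0 mulN1r subrr.
by rewrite innerZl ov (negPf ji) mulr0.
Qed.

(* The leading eigenvectors of T capture u up to the size of (T - mu) u, because
   T <= lambda 1 T - eps on their orthogonal complement. *)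
Lemma leading_residual (T : {linear l2 R -> l2 R}) eps l (v : 'I_l -> l2 R) u mu
  rho :
  compact_operator T -> self_adjoint T ->
  leading_eigenvectors T eps v -> 0 < eps ->
  l2norm (T u - mu *r u) <= rho -> lambda 1 T <= mu + rho -> rho <= eps / 2 ->
  exists q, [/\ spanned v (u - q), ip (u - q) q = 0 & l2norm q <= 2 / eps *
    rho].
Proof.
move=> cT sT lead eps0 Tu lam rho_eps; have [ov eig_v _ _] := lead.
have [q vq q_v] := orthogonal_decomposition u ov.
have q_span x : spanned v x -> ip x q = 0.
  move=> [c ->]; suff : inner (\sum_i c i *: v i) q = 0 by rewrite inner_ip =>
    -[].
  by rewrite inner_suml big1// => i _;
    rewrite innerZl (inner_eq0C (q_v i)) mulr0.
exists q; split; [by []|exact: q_span|].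
(* The span of [v] is invariant under [T], so [<T q, q> = <T u, q>], which the residual keeps close
   to [mu |q|^2]. *)
have TP : ip (T (u - q)) q = 0.
  apply: q_span; case: vq => c ->; exists (fun i => c i * (lambda i.+1 T)%:C%C).
  rewrite linear_sum; apply: eq_bigr => i _; rewrite linearZ /= (eig_v i).2.
  by rewrite scalerA.
have [_ /(_ _ q_v) form] := leading_complement_form cT sT lead.
have uq : ip u q = ip q q.
  by have := q_span _ vq; rewrite !ipE => /eqP; rewrite subr_eq0 => /eqP.
have Tq : ip (T q) q = ip (T u) q.
  by move: TP; rewrite linearB /= !ipE => /eqP; rewrite subr_eq0 => /eqP.
have h : - (rho * l2norm q) <= ip (T u - mu *r u) q.
  rewrite lerNl; apply: le_trans (ler_norm _) _; rewrite normrN.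
  by apply: le_trans (ip_CS _ _) _; rewrite ler_wpM2r ?l2norm_ge0.
move: h form; rewrite Tq !ipE uq -!sqr_l2norm.
set N := l2norm q; have N0 : 0 <= N by exact: l2norm_ge0.
move: (ip _ _) => t h form.
have [N1|N1] := leP N 0.
  by apply: le_trans N1 _; rewrite !mulr_ge0// ?invr_ge0 ?(ltW eps0)//;
    apply: le_trans Tu; exact: l2norm_ge0.
(* [mu - (lambda 1 T - eps) >= eps - rho >= eps / 2]; this gap is the origin of the factor
   [2 / eps]. *)
have rhoN : eps / 2 * N ^+ 2 <= rho * N.
  have : (mu - (lambda 1 T - eps)) * N ^+ 2 <= rho * N by lra.
  apply: le_trans; apply: ler_wpM2r; first exact: sqr_ge0.
  lra.
have : eps / 2 * N <= rho by rewrite -(ler_pM2r N1) -[X in X <= _]mulrA -expr2.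
rewrite mulrAC ler_pdivrMr// => hN.
by rewrite mulrAC ler_pdivlMr// mulrC; lra.
Qed.

End Subspaces.

(** * First-order perturbation of the pencil *)

Section Perturbation.
Context {R : realType} {kappa : nat} (A : 'I_kappa -> {linear l2 R -> l2 R}).
Hypotheses (cA : forall j, compact_operator (A j)) (sA : forall j, self_adjoint
  (A j)).
Context (B : 'I_kappa -> R).
Hypotheses (B0 : forall j, 0 <= B j)
  (AB : forall j x, l2norm (A j x) <= B j * l2norm x).
Context (f : 'I_kappa -> R -> R).

(** Weyl's perturbation bound: a top unit eigenvector at [x] serves as trial vector at [y]. *)
Lemma lambda1_opsum_le x y : has_jth_eigenvalue (opsum f A x) 1 ->
  has_jth_eigenvalue (opsum f A y) 1 ->
  lambda 1 (opsum f A x) <= lambda 1 (opsum f A y) + opdist B f x y.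
Proof.
move=> hx hy; have [z zz Tz] := lambda1_eigenvector hx.
have nz : l2norm z = 1 by exact: l2norm_eq1 zz.
have := rayleigh_le_lambda1 hy (opsum_compact _ _ cA) (opsum_self_adjoint _ _
  sA) z.
have := ip_opsum_dist f AB x y z z;
  rewrite Tz ipZl zz nz !mulr1 ler_norml => /andP[_].
rewrite lerBlDr addrC; move=> h1 h2; apply: le_trans h1 _.
by rewrite lerD2r.
Qed.

Lemma opsum_taylor ws (d : 'I_kappa -> R) e : (forall j, diff_at (f j) ws (d j))
  -> 0 < e ->
  exists2 r, 0 < r & forall h, `|h| < r ->
    \sum_j `|f j (ws + h) - f j ws - h * d j| * B j <= e * `|h|.
Proof.
move=> fd; elim: (index_enum _) e => [|j s IHs] e e0.
  by exists 1 => // h _; rewrite big_nil mulr_ge0// ltW.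
have e2 : 0 < e / 2 by rewrite divr_gt0.
have b1 : 0 < B j + 1 by rewrite ltr_wpDl.
have [r1 r10 h1] := IHs _ e2; have [r2 r20 h2] := fd j _ (divr_gt0 e2 b1).
exists (Num.min r1 r2); first by rewrite lt_min r10.
move=> h; rewrite lt_min => /andP[/h1 H1 /h2 H2].
rewrite big_cons [e]splitr mulrDl lerD//.
apply: le_trans (ler_wpM2r (B0 j) H2) _.
rewrite mulrAC ler_wpM2r// mulrAC -mulrA ler_piMr ?(ltW e2)// ler_pdivrMr//.
by rewrite mul1r lerDl.
Qed.

(** The radius is uniform in [x], as the rate estimate applies this to a vector that changes with
    [k]. *)
Lemma form_taylor ws (d : 'I_kappa -> R) e : (forall j, diff_at (f j) ws (d j))
  -> 0 < e ->
  exists2 r, 0 < r & forall h x, `|h| < r ->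
    `|ip (opsum f A (ws + h) x) x - ip (opsum f A ws x) x
      - h * ip (opsum (fun j => cst (d j)) A ws x) x| <= e * `|h| * ip x x.
Proof.
move=> fd e0; have [r r0 hr] := opsum_taylor fd e0; exists r => // h x /hr H.
rewrite !ip_opsum mulr_sumr -!sumrB.
apply: le_trans (ler_norm_sum _ _ _) _;
  apply: le_trans (ler_wpM2r (ip_ge0 x) H).
rewrite mulr_suml; apply: ler_sum => j _; rewrite mulrA -!mulrBl normrM -mulrA.
rewrite ler_wpM2l//; apply: le_trans (ip_CS _ _) _;
  rewrite -sqr_l2norm expr2 mulrA.
by rewrite ler_wpM2r ?l2norm_ge0.
Qed.

Lemma opdist_lipschitz ws (d : 'I_kappa -> R) : (forall j, diff_at (f j) ws (d
  j)) ->
  exists L r, [/\ 0 <= L, 0 < r &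
    forall h, `|h| < r -> opdist B f (ws + h) ws <= L * `|h|].
Proof.
move=> fd; have [r r0 hr] := opsum_taylor fd ltr01.
exists (1 + \sum_j `|d j| * B j), r; split=> //.
  by rewrite addr_ge0// sumr_ge0// => j _; rewrite mulr_ge0.
move=> h /hr H; rewrite mulrDl; apply: le_trans (lerD H (lexx _)).
rewrite mulr_suml -big_split; apply: ler_sum => j _ /=.
rewrite -mulrA [B j * _]mulrC mulrA -mulrDl ler_wpM2r//.
rewrite -{1}(subrK (h * d j) (f j (ws + h) - f j ws)) (le_trans (ler_normD _
  _))//.
by rewrite lerD2l normrM mulrC.
Qed.

End Perturbation.

(** * Convergence and rate of the procedure *)

Section Main.
Context {R : realType} (a b : R) {kappa : nat} (A : 'I_kappa -> {linear l2 R ->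
  l2 R}).
Context (f : 'I_kappa -> R -> R) (ws : R).
Let Omega := [set` `[a, b]] : set R.
Let l1 x := lambda 1 (opsum f A x).
Hypotheses (cA : forall j, compact_operator (A j)) (sA : forall j, self_adjoint
  (A j)).
Hypothesis (f_cont : forall x j, Omega x -> {for x, continuous (f j)}).
Hypothesis (has1 : forall x, Omega x -> has_jth_eigenvalue (opsum f A x) 1).
Hypothesis (min_ws : global_minimizer l1 Omega ws).

Let cAw x : compact_operator (opsum f A x). Proof. exact: opsum_compact. Qed.
Let sAw x : self_adjoint (opsum f A x). Proof. exact: opsum_self_adjoint. Qed.

Section Procedure.
Context (B : 'I_kappa -> R).
Hypotheses (B0 : forall j, 0 <= B j)
  (AB : forall j x, l2norm (A j x) <= B j * l2norm x).
Context (eps : R) (w : nat -> R).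
Hypotheses (eps0 : 0 < eps) (proc : subspace_procedure (opsum f A) Omega eps w).

Lemma procedure_mem k : Omega (w k).
Proof.
have [w0 [l [v h]]] := proc; case: k => [|k]; first by [].
by have [_ [m [V [_ _ []]]]] := h k.
Qed.

(** For the last clause, [z] lies in the subspace that determines [w k.+1], so its Rayleigh quotient
    there is at most the minimum of the compressed [lambda_max]; that minimum is at most the value
    at [ws], and compression does not increase [lambda_1]. *)
Lemma procedure_step : exists (l : nat -> nat) (v : forall k, 'I_(l k) -> l2 R),
  [/\ forall k, leading_eigenvectors (opsum f A (w k)) eps (v k),
    forall k, exists2 z, spanned (v k) z &
      ip z z = 1 /\ opsum f A (w k) z = l1 (w k) *r z &
    forall j k z, (j <= k)%N -> spanned (v j) z ->
      ip (opsum f A (w k.+1) z) z <= l1 ws * ip z z].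
Proof.
have [_ [l [v h]]] := proc; exists l, v.
have lead k : leading_eigenvectors (opsum f A (w k)) eps (v k) by have [] := h
  k.
have top k : exists2 z, spanned (v k) z &
    ip z z = 1 /\ opsum f A (w k) z = l1 (w k) *r z.
  have [ov eig_v window _] := lead k.
  have l0 : (0 < l k)%N.
    apply/(window 1%N) => //; first exact/has1/procedure_mem.
    by rewrite subrr ltW.
  exists (v k (Ordinal l0)); first exact: spanned_mem.
  split; last by have [] := eig_v (Ordinal l0).
  by have := ov (Ordinal l0) (Ordinal l0); rewrite eqxx inner_self => -[].
split=> // j k z jk vz; have [_ [m [V [oV spanV minV]]]] := h k.
have m0 : (0 < m)%N.
  have [y vy [yy _]] := top j.
  have : spanned V y by rewrite spanV; exact: spanned_subspace vy.
  case: (m) V {oV spanV minV} => // V [c]; rewrite big_ord0 => y0.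
  by move: yy; rewrite y0 ip0l => /eqP; rewrite eq_sym oner_eq0.
have Vz : spanned V z by rewrite spanV; exact: spanned_subspace vz.
have [low _] := lambda_max_compression (sAw (w k.+1)) oV m0.
apply: le_trans (low z Vz) _; apply: ler_wpM2r; first exact: ip_ge0.
have [ws_mem _] := min_ws.
have [_ /(_ ws ws_mem) h1] := minV; apply: le_trans h1 _.
exact: (lambda_max_compression_le (cAw ws) (sAw ws) (has1 ws_mem) oV m0).
Qed.

(** A top eigenvector at [w j] has Rayleigh quotient at most [l1 ws] at the later iterate [w k];
    going back to [w j] costs the distance of the two operators. *)
Lemma lambda1_iterates j k : (j < k)%N -> l1 (w j) <= l1 ws + opdist B f (w j)
  (w k).
Proof.
case: k => // k; rewrite ltnS => jk;
  have [l [v [_ top upper]]] := procedure_step.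
have [z vz [zz Tz]] := top j; have := upper j k z jk vz; rewrite zz mulr1.
have nz : l2norm z = 1 by exact: l2norm_eq1 zz.
have := ip_opsum_dist f AB (w j) (w k.+1) z z.
rewrite Tz ipZl zz nz !mulr1 ler_norml => /andP[_];
  rewrite lerBlDr addrC => h1 h2.
by apply: le_trans h1 _; rewrite lerD2r.
Qed.

Lemma lambda1_iterates_ge k : eps <= l1 (w k).
Proof.
have [l [v [lead _ _]]] := procedure_step.
by have [] := leading_complement_form (cAw _) (sAw _) (lead k);
  rewrite subr_ge0.
Qed.

Hypothesis uniq_ws : forall y, global_minimizer l1 Omega y -> y = ws.

(* Around each y != ws there is a neighbourhood containing at most one iterate,
   by lambda1_iterates; hence, by compactness, the iterates leave every compact
   set avoiding ws. *)
Lemma procedure_cvg e : 0 < e -> \forall k \near \oo, `|w k - ws| < e.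
Proof.
move=> e0; pose K := Omega `&` [set y | e <= `|y - ws|].
have cK : compact K.
  apply: compact_closedI; first exact: segment_compact.
  apply: (@preimage_closed _ _ (fun y : R => `|y - ws|) [set y | e <= y]);
    last exact: closed_ge.
  by move=> y _; apply: cvg_norm; apply: cvgB; [exact: cvg_id|exact: cvg_cst].
have /compact_near_coveringP cov := cK.
have [ws_mem ws_min] := min_ws.
have : \forall k \near \oo, K `<=` [set y | w k != y].
  apply: (cov nat \oo (fun k y => w k != y)) => y [Oy /= ey].
  have gap : l1 ws < l1 y.
    rewrite lt_neqAle ws_min// andbT; apply/negP => /eqP E.
    have /uniq_ws yE : global_minimizer l1 Omega y by split=> // z Oz;
      rewrite -E ws_min.
    by move: ey; rewrite yE subrr normr0 leNgt e0.
  (* If two iterates [w i] and [w k] with [i < k] were within [g] of [y], then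
     [l1 y <= l1 (w i) + g < l1 ws + 3 g], contradicting [l1 y = l1 ws + 4 g]. *)
  pose g := (l1 y - l1 ws) / 4; have g0 : 0 < g by rewrite divr_gt0// subr_gt0.
  have near_y := near_opdist B0 (fun j => @f_cont y j Oy) g0.
  suff [N hN] : exists N, forall k, (N <= k)%N -> ~ opdist B f (w k) y < g.
    exists ([set x | opdist B f x y < g], [set k | (N <= k)%N]).
      by split => //=; exists N.
    move=> [x k] /= [xg Nk]; apply/negP => /eqP wk; apply: (hN k Nk).
    by rewrite wk.
  have [[i hi]|no] := pselect (exists i, opdist B f (w i) y < g); last first.
    by exists 0%N => k _ hk; apply: no; exists k.
  exists i.+1 => k ik hk; have h1 := lambda1_iterates ik.
  have h2 := opdist_triangle f B0 (w i) y (w k);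
    rewrite [opdist B f y (w k)]opdistC in h2.
  have h3 : l1 y <= l1 (w i) + opdist B f y (w i).
    by apply: lambda1_opsum_le => //; apply: has1 => //; exact: procedure_mem.
  rewrite opdistC in h3; have gE : g * 4 = l1 y - l1 ws by rewrite divfK.
  lra.
apply: filterS => k Kk; rewrite ltNge; apply/negP => ek.
by have := Kk (w k) (conj (procedure_mem k) ek); rewrite /= eqxx.
Qed.

Lemma lambda1_min_ge : eps <= l1 ws.
Proof.
apply/ler_addgt0Pr => e e0; have [ws_mem _] := min_ws.
have /nbhs_ballP[r /= r0 hr] := near_opdist B0 (fun j => @f_cont ws j ws_mem)
  e0.
have [N _ hN] := procedure_cvg r0; have wN := hN N (leqnn N).
have := hr (w N); rewrite /ball /= distrC => /(_ wN) h.
apply: le_trans (lambda1_iterates_ge N) _.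
have : l1 (w N) <= l1 ws + opdist B f (w N) ws.
  by apply: lambda1_opsum_le => //; apply: has1 => //; exact: procedure_mem.
by move=> h1; apply: le_trans h1 _; rewrite lerD2l ltW.
Qed.

Lemma rate_one_side (d : 'I_kappa -> R) (s : R) u :
  (forall j, diff_at (f j) ws (d j)) -> s ^+ 2 = 1 ->
  ip u u = 1 -> opsum f A ws u = l1 ws *r u ->
  0 < s * ip (opsum (fun j => cst (d j)) A ws u) u ->
  exists C, \forall k \near \oo, 0 <= s * (w k.+1 - ws) ->
    `|w k.+1 - ws| <= C * (w k - ws) ^+ 2.
Proof.
move=> fd s1 uu Tu; set D := opsum _ A ws; set c := s * _ => c0.
have [ws_mem _] := min_ws.
have nu : l2norm u = 1 by exact: l2norm_eq1 uu.
have [L [rL [L0 rL0 hL]]] := opdist_lipschitz B0 fd.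
have [rT rT0 hT] := form_taylor B0 AB fd (divr_gt0 c0 (ltr0n _ 4)).
have [CD [CD0 hD]] := compact_operator_bounded (opsum_compact (fun j => cst (d
  j)) ws cA) (linear_real_linear (opsum (fun j => cst (d j)) A ws)).
have [CA [CA0 hA]] := compact_operator_bounded (cAw ws) (linear_real_linear
  (opsum f A ws)).
(* [M |h|] bounds the part [q] of [u] missed by the leading eigenvectors, by [leading_residual] with
   [rho = (L + 1) |h|]; [Q |q|^2] will bound the form of [l1 ws - A(ws)] at [q]. *)
pose M := 2 / eps * (L + 1).
have M0 : 0 < M by rewrite mulr_gt0 ?divr_gt0// ltr_wpDl.
pose Q := CA + `|l1 ws|.
have Q0 : 0 <= Q by rewrite addr_ge0.
exists (2 / c * (Q * M ^+ 2)).
(* In order, the radii ensure the Lipschitz bound, the Taylor bound with error [c / 4],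
   [rho <= eps / 2], [|q| <= 1], and [(3 CD + 1) |q| <= c / 4]. *)
pose r := Num.min rL (Num.min rT (Num.min (eps / 2 / (L + 1)) (Num.min M^-1 (c /
  4 / (3 * CD + 1) / M)))).
have r0 : 0 < r.
  rewrite !lt_min rL0 rT0 /= !(divr_gt0, invr_gt0, ltr_wpDl)//;
    first by rewrite M0.
  by rewrite mulr_ge0.
have [l [v [lead _ upper]]] := procedure_step.
have [N _ hN] := procedure_cvg r0.
exists N => // k /= Nk tau0; set h := w k - ws; set tau := w k.+1 - ws.
have := hN k Nk; have := hN k.+1 (leqW Nk); rewrite /= -/h -/tau.
rewrite /r !lt_min => /and5P[_ tT _ _ _] /and5P[hL' _ h2 h3 h4].
have rho_le : opdist B f (w k) ws <= (L + 1) * `|h|.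
  have -> : w k = ws + h by rewrite /h addrC subrK.
  by apply: le_trans (hL h hL') _; rewrite ler_wpM2r// lerDl.
have [|||q [vq uq nq]] := @leading_residual _ _ _ _ _ u (l1 ws) ((L + 1) * `|h|)
  (cAw (w k)) (sAw (w k)) (lead k) eps0.
- rewrite -Tu; apply: le_trans (opsum_dist f AB _ _ _) _.
  by rewrite nu mulr1.
- apply: le_trans (lambda1_opsum_le cA sA AB (has1 (procedure_mem k)) (has1
    ws_mem)) _.
  by rewrite lerD2l.
- by move: h2; rewrite ltr_pdivlMr ?ltr_wpDl// mulrC => /ltW.
have {}nq : l2norm q <= M * `|h| by rewrite /M -mulrA.
have nq1 : l2norm q <= 1.
  by apply: le_trans nq _; move: h3;
    rewrite -[M^-1]mul1r ltr_pdivlMr// mulrC => /ltW.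
have nq2 : (3 * CD + 1) * l2norm q <= c / 4.
  rewrite mulrC -ler_pdivlMr; last by rewrite ltr_wpDl// mulr_ge0.
  by apply: le_trans nq _; move: h4; rewrite ltr_pdivlMr// mulrC => /ltW.
have key1 := upper k k (u - q) (leqnn k) vq.
have qq : ip u q = ip q q by move: uq; rewrite !ipE => /eqP;
  rewrite subr_eq0 => /eqP.
have xx : ip (u - q) (u - q) = 1 - ip q q.
  by rewrite !ipE uu [ip q u]ipC qq; ring.
have q0 : 0 <= ip q q by exact: ip_ge0.
have x1 : ip (u - q) (u - q) <= 1 by rewrite xx gerBl.
(* The source of the square: as [u] is an eigenvector of the symmetric operator at [ws], the terms
   linear in [q] cancel. *)
have Ax : l1 ws * ip (u - q) (u - q) - Q * l2norm q ^+ 2 <= ip (opsum f A ws (u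
  - q)) (u - q).
  have -> : ip (opsum f A ws (u - q)) (u - q) =
      l1 ws * ip (u - q) (u - q) - (l1 ws * ip q q - ip (opsum f A ws q) q).
    rewrite linearB /= Tu !ipE [ip (opsum f A ws q) u](self_adjoint_symmetric
      (sAw ws)) Tu.
    by rewrite ipZr [ip q u]ipC qq uu; ring.
  rewrite lerD2l lerN2 sqr_l2norm mulrDl addrC; apply: lerD; last first.
    by rewrite ler_wpM2r// ler_norm.
  rewrite -ipNl; apply: le_trans (ip_le _ _) _;
    rewrite l2normN -sqr_l2norm expr2 mulrA.
  by rewrite ler_wpM2r ?l2norm_ge0.
have DB x y : D (x - y) = D x - D y.
  exact: (rlinB (linear_real_linear (opsum (fun j => cst (d j)) A ws))).
have Dx : c * (3 / 4) <= s * ip (D (u - q)) (u - q).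
  have -> : s * ip (D (u - q)) (u - q) = c - s * (ip (D q) u + ip (D u) q - ip
    (D q) q).
    by rewrite DB !ipE /c; ring.
  have ns : `|s| = 1 by apply/eqP; rewrite -sqr_norm_eq1 s1.
  suff : `|s * (ip (D q) u + ip (D u) q - ip (D q) q)| <= c / 4.
    by rewrite ler_norml => /andP[_ H]; lra.
  rewrite normrM ns mul1r; apply: le_trans nq2.
  have b1 : `|ip (D q) u| <= CD * l2norm q.
    by apply: le_trans (ip_CS _ _) _; rewrite nu mulr1; exact: hD.
  have b2 : `|ip (D u) q| <= CD * l2norm q.
    by apply: le_trans (ip_CS _ _) _; rewrite ler_wpM2r ?l2norm_ge0//;
      apply: le_trans (hD u) _; rewrite nu mulr1.
  have b3 : `|ip (D q) q| <= CD * l2norm q.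
    apply: le_trans (ip_CS _ _) _; apply: le_trans (hD q).
    by rewrite ler_piMr ?l2norm_ge0.
  have nq0 := l2norm_ge0 q.
  apply: le_trans (ler_normB _ _) _;
    apply: le_trans (lerD (ler_normD _ _) (lexx _)) _.
  by lra.
have := hT tau (u - q) tT; rewrite /tau [ws + _]addrC subrK -/tau -/D => tay.
have tauE : tau = s * `|tau|.
  have : s * tau = `|tau|.
    rewrite -(ger0_norm tau0) normrM (_ : `|s| = 1) ?mul1r//.
    by apply/eqP; rewrite -sqr_norm_eq1 s1.
  by move=> <-; rewrite mulrA -expr2 s1 mul1r.
have t0 : 0 <= `|tau| by [].
(* The slope along [u - q] is at least [3 c / 4], and the Taylor remainder takes [c / 4] of it. *)
have final : `|tau| * (c / 2) <= Q * l2norm q ^+ 2.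
  have X : `|tau| * (c * (3 / 4)) <= tau * ip (D (u - q)) (u - q).
    by apply: le_trans (ler_wpM2l t0 Dx) _;
      rewrite mulrA [`|tau| * s]mulrC -tauE.
  have Y : c / 4 * `|tau| * ip (u - q) (u - q) <= c / 4 * `|tau|.
    by rewrite ler_piMr// mulr_ge0// ltW// divr_gt0.
  move: tay; rewrite ler_norml => /andP[tay _].
  lra.
have bound : Q * l2norm q ^+ 2 <= Q * (M ^+ 2 * h ^+ 2).
  rewrite ler_wpM2l// -[h ^+ 2]real_normK ?num_real// -exprMn.
  apply: lerXn2r nq; rewrite nnegrE; first exact: l2norm_ge0.
  exact: mulr_ge0 (ltW M0) (normr_ge0 h).
rewrite -(ler_pM2r (divr_gt0 c0 (ltr0n _ 2))).
apply: le_trans final _; apply: le_trans bound _.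
have -> // : 2 / c * (Q * M ^+ 2) * h ^+ 2 * (c / 2) = Q * (M ^+ 2 * h ^+ 2).
by field; rewrite gt_eqF.
Qed.

End Procedure.
End Main.

(** * Slopes of the largest eigenvalue *)

Section Slopes.
Context {R : realType} {kappa : nat} (A : 'I_kappa -> {linear l2 R -> l2 R}).
Context (f : 'I_kappa -> R -> R) (ws r : R).
Let l1 x := lambda 1 (opsum f A x).
Hypotheses (cA : forall j, compact_operator (A j)) (sA : forall j, self_adjoint
  (A j)).
Hypotheses (r0 : 0 < r)
  (has1 : forall y, `|y - ws| < r -> has_jth_eigenvalue (opsum f A y) 1)
  (fD : forall j y, `|y - ws| < r -> derivable (f j) y 1)
  (fC1 : forall j, {for ws, continuous (derive1 (f j))})
  (l1_gt0 : 0 < l1 ws).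

(** This is [<A'(y) x, x>], with [A'] the derivative of the pencil. *)
Let slope y x := \sum_j derive1 (f j) y * ip (A j x) x.

Let cAw x : compact_operator (opsum f A x). Proof. exact: opsum_compact. Qed.
Let sAw x : self_adjoint (opsum f A x). Proof. exact: opsum_self_adjoint. Qed.

Let f_cont j y : `|y - ws| < r -> {for y, continuous (f j)}.
Proof.
by move=> yr; apply: differentiable_continuous; apply/derivable1_diffP;
  exact: fD.
Qed.

Let near_ball p : `|p - ws| < r ->
  exists2 s, 0 < s & forall h, `|h| < s -> `|p + h - ws| < r.
Proof.
move=> pr; exists (r - `|p - ws|); first by rewrite subr_gt0.
move=> h; rewrite ltrBrDr => hr; rewrite addrAC addrC.
exact: le_lt_trans (ler_normD _ _) _.
Qed.

Let form_diff p x : `|p - ws| < r ->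
  diff_at (fun y => ip (opsum f A y x) x) p (slope p x).
Proof.
move=> pr; have -> : (fun y => ip (opsum f A y x) x) =
    (fun y => \sum_j f j y * ip (A j x) x).
  by apply/funext => y; rewrite ip_opsum.
by apply: diff_at_sum => j; apply/diff_at_derive1/fD.
Qed.

Let form_le p x : `|p - ws| < r -> ip x x = 1 ->
  exists2 s, 0 < s & forall h, `|h| < s -> ip (opsum f A (p + h) x) x <= l1 (p +
    h).
Proof.
move=> pr xx; have [s s0 hs] := near_ball pr; exists s => // h /hs phr.
have := rayleigh_le_lambda1 (has1 phr) (cAw _) (sAw _) x.
by rewrite xx mulr1.
Qed.

(** The Hellmann-Feynman formula: the Rayleigh quotient of [x] touches [l1] from below at [p]. *)
Lemma derive_lambda1 p x : `|p - ws| < r -> ip x x = 1 ->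
  opsum f A p x = l1 p *r x -> derivable l1 p 1 -> derive1 l1 p = slope p x.
Proof.
move=> pr xx Tx dl.
apply: (diff_at_minorant (diff_at_derive1 dl) (form_diff x pr) _ (form_le pr
  xx)).
by rewrite Tx ipZl xx mulr1.
Qed.

(** Unit top eigenvectors at [u n] are approximate eigenvectors at [ws]. Compactness makes their
    images converge along a subsequence, and dividing by [l1 ws > 0] turns this into convergence of
    the vectors themselves, to a unit eigenvector; slopes then converge since each [f j] is
    continuously differentiable at [ws]. *)
Lemma derive_lambda1_limit (u : nat -> R) : u @ \oo --> ws ->
  (forall n, `|u n - ws| < r) -> (forall n, derivable l1 (u n) 1) ->
  exists (phi : nat -> nat) x, [/\ {homo phi : m n / (m < n)%N}, ip x x = 1,
    opsum f A ws x = l1 ws *r x &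
    derive1 l1 (u (phi n)) @[n --> \oo] --> slope ws x].
Proof.
move=> u_ws ur ud; have [B [B0 AB]] := opsum_bounds cA.
have wsr : `|ws - ws| < r by rewrite subrr normr0.
have /choice[x hx] n : exists x, ip x x = 1 /\ opsum f A (u n) x = l1 (u n) *r
  x.
  by have [x xx Tx] := lambda1_eigenvector (has1 (ur n)); exists x.
have nx n : l2norm (x n) = 1 by exact: l2norm_eq1 (hx n).1.
pose T := opsum f A ws;
  have lT : real_linear T := linear_real_linear (opsum f A ws).
have [C [C0 TC]] := compact_operator_bounded (cAw ws) lT.
have rho0 e : 0 < e -> exists N, forall n, (N <= n)%N -> opdist B f (u n) ws <
  e.
  move=> e0; have /u_ws[N _ hN] := near_opdist B0 (fun j => @f_cont j _ wsr) e0.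
  by exists N.
have res n : l2norm (T (x n) - l1 ws *r x n) <= 2 * opdist B f (u n) ws.
  have -> : T (x n) - l1 ws *r x n =
      - (opsum f A (u n) (x n) - T (x n)) + (l1 (u n) - l1 ws) *r x n.
    by rewrite (hx n).2 rmorphB scalerBl opprB addrA subrK.
  apply: le_trans (l2normD _ _) _;
    rewrite l2normN l2normZ nx mulr1 mulr2n mulrDl mul1r.
  apply: lerD; first by apply: le_trans (opsum_dist f AB _ _ _) _;
    rewrite nx mulr1.
  rewrite ler_norml; apply/andP; split.
    rewrite lerNl opprB lerBlDl [opdist _ _ _ _]opdistC.
    exact: (lambda1_opsum_le cA sA AB (has1 wsr) (has1 (ur n))).
  by rewrite lerBlDl; exact: (lambda1_opsum_le cA sA AB (has1 (ur n)) (has1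
    wsr)).
have xM n : l2norm (x n) <= 1 by rewrite nx.
have [phi [y [hphi hy]]] := compact_subseq (cAw ws) xM.
pose z := (l1 ws)^-1 *r y.
have zx e : 0 < e -> exists N, forall n, (N <= n)%N -> l2norm (x (phi n) - z) <
  e.
  move=> e0; have le0 : 0 < l1 ws * e / 2 by rewrite divr_gt0 ?mulr_gt0.
  have [N1 h1] := hy _ le0; have [N2 h2] := rho0 _ (divr_gt0 le0 (ltr0n _ 2)).
  exists (maxn N1 N2) => n; rewrite geq_max => /andP[n1 n2].
  rewrite -(ltr_pM2l l1_gt0) -{1}(gtr0_norm l1_gt0) -l2normZ scalerBr /z
    scalerA.
  rewrite -rmorphM mulfV ?gt_eqF// scale1r.
  have -> : l1 ws *r x (phi n) - y =
      (T (x (phi n)) - y) - (T (x (phi n)) - l1 ws *r x (phi n)).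
    by apply: ip_inj => t; rewrite !ipE; ring.
  have h3 : l2norm (T (x (phi n)) - l1 ws *r x (phi n)) < l1 ws * e / 2.
    apply: le_lt_trans (res _) _; rewrite mulrC -ltr_pdivlMr//.
    by apply: h2; exact: leq_trans n2 (homo_ltn_ge hphi n).
  by rewrite (splitr (l1 ws * e));
    exact: le_lt_trans (l2normB _ _) (ltrD (h1 n n1) h3).
have nz : l2norm z = 1.
  apply/eqP; rewrite -subr_eq0 -normr_le0; apply/ler_addgt0Pr => e e0;
    rewrite add0r.
  have [N hN] := zx e e0; have := hN N (leqnn N); set v := x _ => vz.
  have := nx (phi N); rewrite -/v => nv.
  have := l2normD (v - z) z; have := l2normB v (v - z);
    rewrite subrK opprB addrCA subrr addr0.
  by rewrite nv ler_norml => *; apply/andP; split; lra.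
have zz : ip z z = 1 by rewrite -sqr_l2norm nz expr1n.
have Tz : T z = l1 ws *r z.
  apply/eqP; rewrite -subr_eq0; apply/eqP/l2norm_eq0/eqP.
  rewrite eq_le l2norm_ge0 andbT; apply/ler_addgt0Pr => e e0; rewrite add0r.
  pose M := C + l1 ws + 1; have M0 : 0 < M by rewrite ltr_wpDl// addr_ge0// ltW.
  have e2 : 0 < e / 2 / M by rewrite !divr_gt0.
  have e4 : 0 < e / 2 / 2 by rewrite !divr_gt0.
  have [N1 h1] := zx _ e2; have [N2 h2] := rho0 _ e4.
  have := h1 _ (leq_maxl N1 N2).
  have := h2 _ (leq_trans (leq_maxr N1 N2) (homo_ltn_ge hphi _)).
  have := res (phi (maxn N1 N2)).
  set v := x _ => hres hrho hv.
  have -> : T z - l1 ws *r z = (T v - l1 ws *r v) - (T (v - z) - l1 ws *r (v -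
    z)).
    by rewrite (rlinB lT) scalerBr; apply: ip_inj => t; rewrite !ipE; ring.
  apply: le_trans (l2normB _ _) _.
  have h3 := l2normB (T (v - z)) (l1 ws *r (v - z));
    rewrite l2normZ gtr0_norm// in h3.
  have h4 := TC (v - z).
  have h5 : M * l2norm (v - z) < e / 2 by rewrite mulrC -ltr_pdivlMr.
  have h6 := l2norm_ge0 (v - z).
  by rewrite /M in h5; lra.
exists phi, z; split=> //.
have -> : (fun n => derive1 l1 (u (phi n))) = (fun n => slope (u (phi n)) (x
  (phi n))).
  by apply/funext => n; apply: derive_lambda1 => //;
    [exact: (hx _).1|exact: (hx _).2].
have phi_oo : phi n @[n --> \oo] --> \oo.
  by move=> P [N _ hN]; exists N => // n Nn; apply: hN;
    exact: leq_trans Nn (homo_ltn_ge hphi n).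
have u_phi : u (phi n) @[n --> \oo] --> ws by exact: (cvg_comp _ _ phi_oo u_ws).
have fderiv j : derive1 (f j) (u (phi n)) @[n --> \oo] --> derive1 (f j) ws.
  by apply: continuous_cvg u_phi; exact: fC1.
have fform j : ip (A j (x (phi n))) (x (phi n)) @[n --> \oo] --> ip (A j z) z.
  apply/cvgrPdist_le => e e0.
  have b1 : 0 < 2 * B j + 1 by rewrite ltr_wpDl// mulr_ge0.
  have [N hN] := zx _ (divr_gt0 e0 b1); exists N => // n /= /hN.
  set v := x _; have nv : l2norm v = 1 by exact: nx.
  rewrite ltr_pdivlMr// => h.
  have -> : ip (A j z) z - ip (A j v) v = - (ip (A j (v - z)) v + ip (A j z) (v
    - z)).
    by rewrite linearB /= !ipE; ring.
  rewrite normrN; apply: le_trans (ler_normD _ _) _.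
  have h1 : `|ip (A j (v - z)) v| <= B j * l2norm (v - z).
    by apply: le_trans (ip_CS _ _) _; rewrite nv mulr1; exact: AB.
  have h2 : `|ip (A j z) (v - z)| <= B j * l2norm (v - z).
    apply: le_trans (ip_CS _ _) _; apply: ler_wpM2r; first exact: l2norm_ge0.
    by apply: le_trans (AB _ _) _; rewrite nz mulr1.
  have := l2norm_ge0 (v - z); lra.
rewrite /slope; elim: (index_enum _) => [|j s IHs].
  under eq_cvg do rewrite big_nil.
  by rewrite big_nil; exact: cvg_cst.
under eq_cvg do rewrite big_cons.
by rewrite big_cons; apply: cvgD => //; apply: cvgM.
Qed.

(* Interior maximizers of s |-> l1 (ws + sg s) + eta s - C s^2 on [0, t] are
   points of differentiability: there l1 is squeezed between a Rayleigh quotient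
   and a parabola. The slope of the parabola is at least - eta. *)
Lemma derivable_lambda1_near sg t0 eta : sg ^+ 2 = 1 -> 0 < t0 -> t0 < r -> 0 <
  eta ->
  (forall s, 0 <= s <= t0 -> l1 ws <= l1 (ws + sg * s)) ->
  exists p, [/\ `|p - ws| < t0, derivable l1 p 1 & - eta <= sg * derive1 l1 p].
Proof.
move=> sg1 t00 t0r eta0 l1min; have [B [B0 AB]] := opsum_bounds cA.
have nsg : `|sg| = 1 by apply/eqP; rewrite -sqr_norm_eq1 sg1.
have sgr s : 0 <= s <= t0 -> `|ws + sg * s - ws| < r.
  move=> /andP[s0 st]; rewrite addrAC subrr add0r normrM nsg mul1r ger0_norm//.
  exact: le_lt_trans t0r.
(* Chosen so that [g t0 = l1 ws - 1 < g 0], which keeps the maximizer away from [t0]. *)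
pose K := (l1 (ws + sg * t0) - l1 ws + eta * t0 + 1) / t0 ^+ 2.
have K0 : 0 < K.
  rewrite divr_gt0 ?exprn_gt0//; have := l1min t0;
    rewrite lexx (ltW t00) => /(_ isT) h.
  have := mulr_gt0 eta0 t00; lra.
pose g s := l1 (ws + sg * s) + (eta * s - K * s ^+ 2).
have l1_cont y : `|y - ws| < r -> {for y, continuous l1}.
  move=> yr; apply/cvgrPdist_le => e e0.
  have near1 := near_opdist B0 (fun j => @f_cont j _ yr) e0.
  have [s s0 hs] := near_ball yr.
  have near2 : \forall v \near y, `|v - ws| < r.
    apply/nbhs_ballP; exists s => // v; rewrite /ball /= distrC => vs.
    by have := hs _ vs; rewrite [y + (v - y)]addrC subrK.
  apply: filterS2 near1 near2 => v h1 h2; rewrite distrC ler_norml; apply/andP;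
    split.
    rewrite lerNl opprB lerBlDl;
      apply: le_trans (lambda1_opsum_le cA sA AB (has1 yr) (has1 h2)) _.
    by rewrite lerD2l opdistC ltW.
  rewrite lerBlDl; apply: le_trans (lambda1_opsum_le cA sA AB (has1 h2) (has1
    yr)) _.
  by rewrite lerD2l ltW.
have g_cont : {within `[0, t0], continuous g}.
  apply: continuous_in_subspaceT => s; rewrite inE /= in_itv /= => st.
  apply: cvgD; last first.
    apply: cvgB; first by apply: cvgM; [exact: cvg_cst|exact: cvg_id].
    by apply: cvgM; [exact: cvg_cst|exact: exprn_continuous].
  apply: (@cvg_comp _ _ _ (fun s => ws + sg * s) l1 _ (nbhs (ws + sg * s)));
    last exact/l1_cont/sgr.
  apply: cvgD; first exact: cvg_cst.
  by apply: cvgM; [exact: cvg_cst|exact: cvg_id].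
have [s0] := EVT_max (ltW t00) g_cont; rewrite in_itv /= => s0t gmax.
have g0 : g 0 = l1 ws by rewrite /g !mulr0 expr0n mulr0 subr0 !addr0.
have [s1 /andP[s10 s1t] gs1] : exists2 s1, 0 < s1 <= t0 & l1 ws < g s1.
  (* For such [s1], [eta s1 - K s1^2 >= eta s1 / 2 > 0], so [g s1 > g 0] and the maximizer is not
     0. *)
  exists (Num.min t0 (eta / (2 * K))).
    by rewrite ge_min lexx /= lt_min t00 divr_gt0// mulr_gt0.
  set s1 := Num.min _ _.
  have s10 : 0 < s1 by rewrite lt_min t00 divr_gt0// mulr_gt0.
  have s1t : s1 <= t0 by rewrite ge_min lexx.
  have s1K : s1 * (2 * K) <= eta.
    have : s1 <= eta / (2 * K) by rewrite /s1 ge_min lexx orbT.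
    by rewrite ler_pdivlMr// mulr_gt0.
  have h1 := l1min s1; rewrite (ltW s10) s1t in h1; have {}h1 := h1 isT.
  apply: le_lt_trans h1 _; rewrite /g ltrDl.
  have -> : eta * s1 - K * s1 ^+ 2 = s1 * (eta - s1 * (2 * K) / 2) by field.
  by apply: mulr_gt0 => //; lra.
have gt0 : g t0 < l1 ws.
  have E : K * t0 ^+ 2 = l1 (ws + sg * t0) - l1 ws + eta * t0 + 1.
    by rewrite divfK// expf_eq0 /= gt_eqF.
  by rewrite /g E; lra.
have gs0 : l1 ws < g s0.
  by apply: lt_le_trans gs1 _; apply: gmax; rewrite in_itv /= (ltW s10).
have s00 : 0 < s0.
  rewrite lt_def; have /andP[-> _] := s0t; rewrite andbT.
  by apply/negP => /eqP E; move: gs0; rewrite E g0 ltxx.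
have s0lt : s0 < t0.
  rewrite lt_def; have /andP[_ ->] := s0t; rewrite andbT.
  by apply/negP => /eqP E; move: gs0; rewrite -E ltNge (ltW gt0).
pose p := ws + sg * s0; have pr : `|p - ws| < r by exact: sgr.
(* Solving [g s <= g s0] for [l1] gives the parabola [F], in the variable [y = ws + sg s]; [d] is
   its slope at [p]. *)
pose d := sg * (2 * K * s0 - eta).
pose F y := l1 p + d * (y - p) + K * (y - p) ^+ 2.
have Fd : diff_at F p d.
  move=> e e0; exists (e / K); first exact: divr_gt0.
  move=> h; rewrite ltr_pdivlMr// => hK.
  have -> : F (p + h) - F p - h * d = K * `|h| * `|h|.
    by rewrite -mulrA -expr2 real_normK ?num_real// /F [p + h]addrC addrK subrr;
      ring.
  rewrite ger0_norm; last exact: mulr_ge0 (mulr_ge0 (ltW K0) (normr_ge0 h))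
    (normr_ge0 h).
  by rewrite ler_wpM2r// mulrC ltW.
have Fmaj : exists2 s, 0 < s & forall h, `|h| < s -> l1 (p + h) <= F (p + h).
  exists (Num.min s0 (t0 - s0)); first by rewrite lt_min s00 subr_gt0.
  move=> h; rewrite lt_min => /andP[h1 h2].
  have nh : `|sg * h| = `|h| by rewrite normrM nsg mul1r.
  have : 0 <= s0 + sg * h <= t0.
    move: h1 h2; rewrite -nh !ltr_norml => /andP[a1 _] /andP[_ a2]; apply/andP;
      split; lra.
  move=> /(gmax (s0 + sg * h)); rewrite /g.
  have -> : ws + sg * (s0 + sg * h) = p + h.
    by rewrite mulrDr mulrA -expr2 sg1 mul1r addrA.
  rewrite -/p => H.
  have E : (sg * h) ^+ 2 = h ^+ 2 by rewrite exprMn sg1 mul1r.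
  rewrite -(lerD2r (eta * (s0 + sg * h) - K * (s0 + sg * h) ^+ 2)).
  apply: le_trans H _; rewrite /F /d [p + h]addrC addrK.
  have -> : sg * (2 * K * s0 - eta) * h = (2 * K * s0 - eta) * (sg * h) by ring.
  by rewrite -E le_eqVlt; apply/orP; left; apply/eqP; ring.
have Fp : F p = l1 p by rewrite /F subrr expr0n !mulr0 !addr0.
have [x xx Tx] := lambda1_eigenvector (has1 pr).
have lowp : ip (opsum f A p x) x = l1 p by rewrite Tx ipZl xx mulr1.
have low := form_le pr xx; have lowd := form_diff x pr.
have dE : d = slope p x.
  apply: (diff_at_minorant Fd lowd); first by rewrite lowp.
  have [q1 q10 hq1] := low; have [q2 q20 hq2] := Fmaj.
  exists (Num.min q1 q2); first by rewrite lt_min q10.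
  by move=> h; rewrite lt_min => /andP[/hq1 + /hq2]; exact: le_trans.
have dl : diff_at l1 p d.
  rewrite -dE in lowd; apply: (diff_at_squeeze lowd Fd lowp Fp).
  have [q1 q10 hq1] := low; have [q2 q20 hq2] := Fmaj.
  exists (Num.min q1 q2); first by rewrite lt_min q10.
  by move=> h; rewrite lt_min => /andP[/hq1 -> /hq2 ->].
have [dp l1p] := diff_at_derivable dl; exists p; split; [|exact: dp|].
  by rewrite /p addrAC subrr add0r normrM nsg mul1r gtr0_norm.
rewrite l1p /d mulrA -expr2 sg1 mul1r lerBrDr addNr.
exact: mulr_ge0 (mulr_ge0 (ler0n _ 2) (ltW K0)) (ltW s00).
Qed.

Lemma clarke_slope sg t0 : sg ^+ 2 = 1 -> 0 < t0 ->
  (forall s, 0 <= s <= t0 -> l1 ws <= l1 (ws + sg * s)) ->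
  ~ boundary (clarke_derivative l1 ws) 0 ->
  exists u, [/\ ip u u = 1, opsum f A ws u = l1 ws *r u & 0 < sg * slope ws u].
Proof.
move=> sg1 t00 l1min nbd; apply: contrapT => no.
have slope_le u : ip u u = 1 -> opsum f A ws u = l1 ws *r u -> sg * slope ws u
  <= 0.
  by move=> uu Tu; rewrite leNgt; apply/negP => s0; apply: no; exists u.
have nsg : `|sg| = 1 by apply/eqP; rewrite -sqr_norm_eq1 sg1.
have sub : clarke_derivative l1 ws `<=` [set L | sg * L <= 0].
  apply: smallest_sub.
    move=> x y lam /set_mem hx /set_mem hy; apply/mem_set.
    change (sg * ((lam%:num : R) * x + (1 - lam%:num) * y) <= 0).
    have -> : sg * ((lam%:num : R) * x + (1 - lam%:num) * y) =
        lam%:num * (sg * x) + (1 - lam%:num) * (sg * y) by ring.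
    rewrite -[leRHS]addr0; apply: lerD; apply: mulr_ge0_le0 => //.
  move=> L [u [u_ws ud uL]].
  have [N _ hN] : \forall n \near \oo, `|u n - ws| < r.
    by move/cvgrPdist_lt : u_ws => /(_ r r0); apply: filterS => n;
      rewrite distrC.
  (* The Clarke derivative only asks that [u] tend to [ws]; dropping [N] terms brings all points
     within [r]. *)
  have [|||phi [x [hphi xx Tx]]] := @derive_lambda1_limit (fun n => u (N +
    n)%N).
  - have addN_oo : (N + n)%N @[n --> \oo] --> \oo.
      by move=> P [M _ hM]; exists M => // n Mn; apply: hM;
        exact: leq_trans Mn (leq_addl _ _).
    exact: (cvg_comp _ _ addN_oo u_ws).
  - by move=> n; apply: hN; rewrite /= leq_addr.
  - by move=> n; exact: ud.
  have : derive1 l1 (u (N + phi n)%N) @[n --> \oo] --> L.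
    apply: (@cvg_comp _ _ _ (fun n => (N + phi n)%N) (fun k => derive1 l1 (u k))
      _ \oo); last exact: uL.
    move=> P [M _ hM]; exists M => // n Mn; apply: hM => /=.
    by apply: leq_trans (leq_trans Mn (homo_ltn_ge hphi n)) (leq_addl _ _).
  move=> c1 c2; rewrite /= (cvg_unique _ c1 c2)//.
  exact: slope_le.
apply: nbd; split.
  have hullS (S : set R) : S `<=` convex_hull S by exact: sub_smallest.
  apply: subset_closure; rewrite /clarke_derivative; apply: hullS => /=.
  (* Points tending to [ws] at which the derivative in direction [sg] is at least [- 1 / (n + 1)]: a
     limit of these derivatives is nonnegative in that direction, and by [slope_le] also
     nonpositive, so 0 lies in the Clarke derivative. *)
  have /choice[u hu] (n : nat) : exists p, [/\ `|p - ws| < n.+1%:R^-1, `|p - ws|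
    < r,
      derivable l1 p 1 & - n.+1%:R^-1 <= sg * derive1 l1 p].
    pose t := Num.min t0 (Num.min r n.+1%:R^-1) / 2.
    have n0 : 0 < n.+1%:R^-1 :> R by rewrite invr_gt0 ltr0n.
    have m0 : 0 < Num.min t0 (Num.min r n.+1%:R^-1) by rewrite !lt_min t00 r0.
    have t0' : 0 < t by rewrite divr_gt0.
    have : t < Num.min t0 (Num.min r n.+1%:R^-1) by rewrite ltr_pdivrMr//
      ltr_pMr// ltr1n.
    rewrite !lt_min => /and3P[tt0 tr tn].
    have [|p [pt pd ps]] := derivable_lambda1_near sg1 t0' tr n0.
      by move=> s /andP[s0 st]; apply: l1min;
        rewrite s0 (le_trans st (ltW tt0)).
    by exists p; split=> //; apply: lt_trans pt _.
  have u_ws : u @ \oo --> ws.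
    apply/cvgrPdist_lt => e e0.
    have /cvgrPdist_lt/(_ e e0) := @cvg_harmonic R; apply: filterS => n.
    rewrite sub0r normrN /harmonic ger0_norm ?invr_ge0// => ne.
    by rewrite distrC; have [h _ _ _] := hu n; exact: lt_trans ne.
  have [phi [x [hphi xx Tx lim]]] := derive_lambda1_limit u_ws (fun n => let:
    And4 _ h _ _ := hu n in h) (fun n => let: And4 _ _ h _ := hu n in h).
  have phi_oo : phi n @[n --> \oo] --> \oo.
    by move=> P [N _ hN]; exists N => // n Nn; apply: hN;
      exact: leq_trans Nn (homo_ltn_ge hphi n).
  exists (u \o phi); split.
  - exact: (cvg_comp _ _ phi_oo u_ws).
  - by move=> k; have [] := hu (phi k).
  - suff <- : slope ws x = 0 by [].
    have h1 := slope_le _ xx Tx.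
    have h2 : 0 <= sg * slope ws x.
      have lim2 : sg * derive1 l1 (u (phi n)) + harmonic (phi n) @[n --> \oo]
        --> sg * slope ws x + 0.
        apply: cvgD; first by apply: cvgM; [exact: cvg_cst|exact: lim].
        exact: (cvg_comp _ _ phi_oo cvg_harmonic).
      rewrite addr0 in lim2; rewrite -(cvg_lim _ lim2)//; apply: limr_ge.
        by apply/cvg_ex; eexists; exact: lim2.
      exists 0%N => // n _ /=; have [_ _ _] := hu (phi n).
      by rewrite -subr_ge0 opprK.
    have : sg * slope ws x = 0 by apply/eqP; rewrite eq_le h1.
    move/eqP; rewrite mulf_eq0 => /orP[/eqP sg0|/eqP//].
    by move: sg1; rewrite sg0 expr0n => /eqP; rewrite eq_sym oner_eq0.
move=> /nbhs_ballP[e /= e0 he].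
(* A ball around 0 inside the Clarke derivative would contain this point, which lies outside the
   half-line of [sub]. *)
have : clarke_derivative l1 ws (sg * (e / 2)).
  apply: he; rewrite /ball /= sub0r normrN normrM nsg mul1r gtr0_norm
    ?divr_gt0//.
  by rewrite ltr_pdivrMr// ltr_pMr// ltr1n.
move/sub => /=; rewrite mulrA -expr2 sg1 mul1r leNgt divr_gt0//.
Qed.

End Slopes.

(** * Combination of the two sides of the minimizer *)

Theorem theorem4p7 (R : realType) (a b : R) (U : set R)
    (kappa : nat) (f : 'I_kappa -> R -> R)
    (A : 'I_kappa -> {linear l2 R -> l2 R})
    (eps ws : R) (K : nat) (w : nat -> R)
    (Omega := [set` `[a, b]]) (Aw := opsum f A) :
  open U -> is_interval U -> Omega `<=` U ->
  (forall j, real_analytic_on U (f j)) ->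
  (forall j, compact_operator (A j)) ->
  (forall j, self_adjoint (A j)) ->
  (forall x, Omega x -> has_jth_eigenvalue (Aw x) 1) ->
  global_minimizer (fun x => lambda 1 (Aw x)) Omega ws ->
  (forall y, global_minimizer (fun x => lambda 1 (Aw x)) Omega y -> y = ws) ->
  (2 <= K)%N ->
  dim_eq (gen_eigenspace (Aw ws) (lambda 1 (Aw ws))) K ->
  (\forall x \near ws, forall j, (1 <= j <= K)%N ->
     has_jth_eigenvalue (Aw x) j) ->
  (forall j, (1 <= j <= K)%N ->
     ~ boundary (clarke_derivative (fun x => lambda j (Aw x)) ws) 0) ->
  0 < eps ->
  subspace_procedure Aw Omega eps w ->
  exists C : R, \forall k \near \oo,
    `|w k.+1 - ws| <= C * (w k - ws) ^+ 2.
Proof.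
move=> _ _ OU f_an cA sA has1 min_ws uniq_ws K2 _ has_near bd eps0 proc.
have [ws_mem ws_min] := min_ws; have Uws := OU _ ws_mem.
have [B [B0 AB]] := opsum_bounds cA.
have f_cont x j : Omega x -> {for x, continuous (f j)}.
  move=> Ox; have [/nbhs_singleton df _] := real_analytic_C1 (f_an j) (OU _ Ox).
  by apply: differentiable_continuous; apply/derivable1_diffP.
have l1_gt0 : 0 < lambda 1 (Aw ws).
  apply: (lt_le_trans eps0).
  exact: (lambda1_min_ge cA sA f_cont has1 min_ws B0 AB eps0 proc uniq_ws).
have f_near : \forall x \near ws, forall j, derivable (f j) x 1.
  exact: (@filter_forall R _ (fun j x => derivable (f j) x 1) (nbhs ws) _
    (fun j => (real_analytic_C1 (f_an j) Uws).1)).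
(* The Clarke derivative is two-sided, so points outside [Omega] enter when [ws] is an end point;
   this ball is not confined to [Omega]. *)
have [r r0 hr] : exists2 r, 0 < r & forall y, `|y - ws| < r ->
    has_jth_eigenvalue (Aw y) 1 /\ forall j, derivable (f j) y 1.
  have : \forall y \near ws, has_jth_eigenvalue (Aw y) 1 /\ forall j, derivable
    (f j) y 1.
    apply: filterS2 has_near f_near => y h1 h2; split=> //; apply: h1.
    by rewrite leqnn (leq_trans _ K2).
  move=> /nbhs_ballP[r /= r0 hr]; exists r => // y yr; apply: hr.
  by rewrite /ball /= distrC.
have fC1 j : {for ws, continuous (derive1 (f j))}.
  by have [] := real_analytic_C1 (f_an j) Uws.
have fD j : diff_at (f j) ws (derive1 (f j) ws).
  by apply/diff_at_derive1/(hr ws _).2; rewrite subrr normr0.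
have bd1 : ~ boundary (clarke_derivative (fun x => lambda 1 (Aw x)) ws) 0.
  by apply: bd; rewrite leqnn (leq_trans _ K2).
have side sg t0 : sg ^+ 2 = 1 -> 0 < t0 -> (forall s, 0 <= s <= t0 -> Omega (ws
  + sg * s)) ->
    exists C, \forall k \near \oo, 0 <= sg * (w k.+1 - ws) ->
      `|w k.+1 - ws| <= C * (w k - ws) ^+ 2.
  move=> sg1 t00 seg.
  have [u [uu Tu su]] := clarke_slope cA sA r0 (fun y h => (hr y h).1)
    (fun j y h => (hr y h).2 j) fC1 l1_gt0 sg1 t00 (fun s h => ws_min _ (seg s
      h)) bd1.
  apply: (rate_one_side cA sA f_cont has1 min_ws B0 AB eps0 proc uniq_ws fD sg1
    uu Tu).
  by rewrite ip_opsum.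
(* On a side where [Omega] does not extend beyond [ws], the sign condition forces [w k.+1 = ws]. *)
have trivial_side sg : (forall x, Omega x -> sg * (x - ws) <= 0) -> sg != 0 ->
    exists C, \forall k \near \oo, 0 <= sg * (w k.+1 - ws) ->
      `|w k.+1 - ws| <= C * (w k - ws) ^+ 2.
  move=> le0 sg0; exists 0; exists 0%N => // k _ ge0.
  have := le0 _ (procedure_mem proc k.+1) => le0k.
  have /eqP : sg * (w k.+1 - ws) = 0 by apply/eqP; rewrite eq_le le0k ge0.
  by rewrite mulf_eq0 (negPf sg0) => /eqP ->; rewrite normr0 mul0r.
move: (ws_mem); rewrite /Omega /= in_itv /= => /andP[a_ws ws_b].
have [C1 h1] : exists C, \forall k \near \oo, 0 <= 1 * (w k.+1 - ws) ->
    `|w k.+1 - ws| <= C * (w k - ws) ^+ 2.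
  move: ws_b; rewrite le_eqVlt => /predU1P[wsb|wsb].
    apply: trivial_side; rewrite ?oner_eq0// => x;
      rewrite /Omega /= in_itv /= wsb => /andP[_ xb].
    by rewrite mul1r subr_le0.
  apply: (side 1 (b - ws)); rewrite ?expr1n ?subr_gt0// => s /andP[s0 sb].
  by rewrite /Omega /= in_itv /= mul1r -lerBrDl sb andbT (le_trans a_ws)//
    lerDl.
have [C2 h2] : exists C, \forall k \near \oo, 0 <= -1 * (w k.+1 - ws) ->
    `|w k.+1 - ws| <= C * (w k - ws) ^+ 2.
  move: a_ws; rewrite le_eqVlt => /predU1P[wsa|wsa].
    apply: trivial_side; rewrite ?oppr_eq0 ?oner_eq0// => x;
      rewrite /Omega /= in_itv /= -wsa => /andP[ax _].
    by rewrite mulN1r oppr_le0 subr_ge0.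
  apply: (side (-1) (ws - a));
    rewrite ?sqrrN ?expr1n ?subr_gt0// => s /andP[s0 sb].
  rewrite /Omega /= in_itv /= mulN1r lerBrDr -lerBrDl sb /= (le_trans _ ws_b)//.
  by rewrite gerBl.
exists (Num.max C1 C2); apply: filterS2 h1 h2 => k h1 h2.
have [ge0|le0] := leP 0 (w k.+1 - ws).
  apply: le_trans (h1 _) _; first by rewrite mul1r.
  by rewrite ler_wpM2r ?sqr_ge0// le_max lexx.
apply: le_trans (h2 _) _; first by rewrite mulN1r oppr_ge0 ltW.
by rewrite ler_wpM2r ?sqr_ge0// le_max lexx orbT.
Qed.
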